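(* Let $d\ge5$. Then $$\liminf_{n\to\infty}\mathbb{P}_v\big(\Psi(\widetilde{G}_n^d)=v\big)>0.$$
   Context: $(X_n)_{n\ge0}$ is the simple random walk on the nearest-neighbour lattice $\mathbb{Z}^d$; $\mathbb{P}_v$ is its law when started at the source $X_0=v\in\mathbb{Z}^d$ (the probability above does not depend on $v$). Let $V_n=\{X_0,\dots,X_n\}$ be the set of vertices visited in the first $n$ steps, and let $\widetilde{G}_n^d=\mathbb{Z}^d[V_n]$ be the subgraph of $\mathbb{Z}^d$ induced by $V_n$. For a finite connected graph $G$, a diametrical path is a path in $G$ of length $\mathrm{diam}(G)$ joining two vertices at graph distance $\mathrm{diam}(G)$. The estimator $\Psi$ is the randomised function which, on input $G$, selects a uniformly random diametrical path of $G$ and outputs one of its two endpoints uniformly at random. *)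

(* Defs.v *)
From HB Require Import structures.
From mathcomp Require Import all_boot all_order all_algebra finmap.
From mathcomp Require Import all_classical all_reals all_analysis.

Set Implicit Arguments.
Unset Strict Implicit.
Unset Printing Implicit Defensive.

Import Order.TTheory GRing.Theory Num.Theory.

Local Open Scope classical_set_scope.
Local Open Scope ring_scope.

Section Graph.
Variables (T : finType) (e : rel T).

(* Length of a shortest walk from x to y.  Shortest walks have length
   less than #|T|; the value is #|T| when y cannot be reached from x. *)
Definition gdist (x y : T) : nat :=
  find (fun k => [exists p : k.-tuple T, path e x p && (last x p == y)])
       (iota 0 #|T|).

Definition gdiam : nat := \max_(x : T) \max_(y : T) gdist x y.

(* A path is encoded as the sequence of its gdiam.+1 vertices, listed from
   one endpoint to the other.  When gdiam > 0 every path of the graph thus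
   occurs exactly twice, once per orientation. *)
Definition diametrical (p : gdiam.+1.-tuple T) : bool :=
  [&& sorted e p, uniq p & gdist (tnth p ord0) (tnth p ord_max) == gdiam].

(* Probability that the estimator Psi, run on this graph, outputs a vertex
   in A: a uniform diametrical path, then a fair choice between its two
   endpoints.  Counting paths with orientation does not change this law, as
   the two orientations of a path have the same endpoints. *)
Definition Psi_law (R : realType) (A : pred T) : R :=
  \sum_(p : gdiam.+1.-tuple T | diametrical p)
    #|[set q : gdiam.+1.-tuple T | diametrical q]%SET|%:R^-1 *
    (2^-1 * (A (tnth p ord0))%:R + 2^-1 * (A (tnth p ord_max))%:R).

End Graph.

Section Lattice.
Variable d : nat.

Definition lattice_adj : rel 'rV[int]_d :=
  fun x y => \sum_(i < d) `|x 0 i - y 0 i| == 1.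

Definition induced_adj (V : {fset 'rV[int]_d}) : rel V :=
  fun x y => lattice_adj (val x) (val y).

Definition srw_step (R : realType) (x y : 'rV[int]_d) : R :=
  if lattice_adj x y then ((2 * d)%:R)^-1 else 0.

(* Z^d is countable and discrete, so measurability of X n amounts to
   measurability of its fibres. *)
Definition is_srw (R : realType) (disp : measure_display)
    (Om : measurableType disp) (P : probability Om R)
    (v : 'rV[int]_d) (X : nat -> Om -> 'rV[int]_d) : Prop :=
  (forall n x, measurable (X n @^-1` [set x])) /\
  (forall n (x : nat -> 'rV[int]_d),
    P [set w | forall i, (i <= n)%N -> X i w = x i] =
    ((x 0%N == v)%:R * \prod_(i < n) srw_step R (x i) (x i.+1))%:E).

Definition visited (Om : Type) (X : nat -> Om -> 'rV[int]_d) (n : nat)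
    (w : Om) : {fset 'rV[int]_d} :=
  [fset x in [seq X i w | i <- iota 0 n.+1]]%fset.

(* P (Psi (Z^d[V_n]) = v), with Psi's own randomness integrated out given
   the walk. *)
Definition Psi_hits (R : realType) (disp : measure_display)
    (Om : measurableType disp) (P : probability Om R)
    (X : nat -> Om -> 'rV[int]_d) (v : 'rV[int]_d) (n : nat) : \bar R :=
  'E_P[fun w => Psi_law (@induced_adj (visited X n w)) R (fun x => val x == v)].

End Lattice.

(* Main.v *)
Require Import Defs.
From HB Require Import structures.
From mathcomp Require Import all_boot all_order all_algebra finmap.
From mathcomp Require Import all_classical all_reals all_analysis.
From mathcomp Require Import zify ring lra.

Set Implicit Arguments.
Unset Strict Implicit.
Unset Printing Implicit Defensive.

Import Order.TTheory GRing.Theory Num.Theory.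

Local Open Scope ring_scope.

(** Why the theorem holds.

Geometry. Call [t] a cut time of the walk if no point visited before [t] is
equal or adjacent to a point visited after [t]. A path between the two sides
goes through the cut point, hence distances add up along cut points, and the
point at time [t] is at a distance from the start which is at least the number
of cut times up to [t] ([count_cut_gdist]). Suppose that every time [s > 0] is
followed by a cut time [t], or by the final time [t], such that [t - s] is less
than the number of cut times up to [t]. Then the start is farther than the point
at time [s] from everything visited after [t], and the point at time [t] is
farther from the start than any two points visited between [s] and [t] are from
one another. So the start belongs to all diametrical pairs ([gdiam_start]), and
the estimator finds it with probability one half at least ([Psi_law_ge_half]). It remains to bound
the probability of this event, [good], from below, uniformly in the length of
the walk, which is a uniform word of unit steps.

Density of cut times. For [d >= 5] the walk is after [n] steps near a given
point with probability of order at most [n ^ (- 5 / 2)] ([near_bound]), and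
this remains summable after multiplication by [n]. Make the walk go straight for
[L] steps before and after a given time. The free parts of its past and of its
future have to undo these steps before they meet, so for [L] large the expected
number of contacts is small, and the given time is a cut time with probability
at least some [rho > 0] ([straight_cut_ge]). The same count allows for a
straight path of any length [J] which ends at the cut point and which the future
has to avoid as well. As contacts between remote times are rare, being a cut
time is almost a local event; it is independent in disjoint windows, so some
window length [M] makes the absence of cut times in a window less likely than
[rho / 2] ([mean_no_cut]).

Good starting times. Give weight [1] to cut times and weight [-1] to the times
which are followed by [M] times without a cut time. In a walk of length [N] the
expected total weight is about [rho * N / 2] at least. Weights are at most one,
so there are at least as many leaders, that is times from which all partial sums
are positive ([sum_le_leaders]). After a leader, a stretch of [g] times without
cut times is preceded by more than [g - M] cut times. A leader is itself a cut
time, and the line behind it is free. So [M + 1] straight steps followed by the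
walk seen from a leader form a good walk ([leader_good]). By stationarity,
letting [N] grow while the length [n] of the observed part is fixed, the
probability that [M + 1] straight steps followed by [n] free ones are good is at
least [rho / 4] ([good_after_straight]); the straight steps cost a constant
factor. *)

(** * Uniform expectation over words *)

Section Mean.
Variables (R : realFieldType) (A : finType).
Hypothesis A_gt0 : (0 < #|A|)%N.
Implicit Types (f g : seq A -> R) (m n : nat).

(** Expectation at a uniform word of length [n]. Averaging one letter at a time
turns conditioning on the first letters into [mean_cat]. *)
Fixpoint mean n f : R :=
  if n is m.+1 then #|A|%:R^-1 * \sum_(a : A) mean m (fun s => f (a :: s))
  else f [::].

Let card_neq0 : #|A|%:R != 0 :> R.
Proof. by rewrite pnatr_eq0 -lt0n. Qed.

Lemma le_mean n f g : (forall s, size s = n -> f s <= g s) ->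
  mean n f <= mean n g.
Proof.
elim: n f g => [|n IHn] f g fg /=; first exact: fg.
rewrite ler_wpM2l ?invr_ge0 ?ler0n //; apply: ler_sum => a _.
by apply: IHn => s ss; apply: fg; rewrite /= ss.
Qed.

Lemma eq_mean n f g : (forall s, size s = n -> f s = g s) ->
  mean n f = mean n g.
Proof. by move=> fg; apply/eqP; rewrite eq_le !le_mean // => s /fg ->. Qed.

Lemma meanD n f g : mean n (fun s => f s + g s) = mean n f + mean n g.
Proof.
elim: n f g => [//|n IHn] f g /=.
by rewrite -mulrDr -big_split /=; congr (_ * _); apply: eq_bigr => a _; rewrite IHn.
Qed.

Lemma meanZ n c f : mean n (fun s => c * f s) = c * mean n f.
Proof.
elim: n f => [//|n IHn] f /=.
rewrite [RHS]mulrCA; congr (_ * _); rewrite mulr_sumr.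
by apply: eq_bigr => a _; rewrite IHn.
Qed.

Lemma meanB n f g : mean n (fun s => f s - g s) = mean n f - mean n g.
Proof.
rewrite -[- mean n g]mulN1r -meanZ -meanD.
by apply: eq_mean => s _; rewrite mulN1r.
Qed.

Lemma mean_cst n c : mean n (fun=> c) = c.
Proof.
elim: n => [//|n IHn] /=; rewrite (eq_bigr (fun=> c)) // sumr_const.
by rewrite -[c *+ _]mulr_natl mulKf.
Qed.

Lemma mean_sum n (I : Type) (r : seq I) (P : pred I) (F : I -> seq A -> R) :
  mean n (fun s => \sum_(i <- r | P i) F i s) =
  \sum_(i <- r | P i) mean n (F i).
Proof.
elim: r => [|i r IHr].
  rewrite big_nil -[RHS](mean_cst n); apply: eq_mean => s _.
  by rewrite big_nil.
rewrite big_cons -IHr; case: ifP => Pi; rewrite -?meanD;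
  by apply: eq_mean => s _; rewrite big_cons Pi.
Qed.

Lemma mean_ge0 n f : (forall s, size s = n -> 0 <= f s) -> 0 <= mean n f.
Proof. by move=> f0; rewrite -(mean_cst n 0); apply: le_mean. Qed.

Lemma mean_cat m n f :
  mean (m + n) f = mean m (fun s => mean n (fun t => f (s ++ t))).
Proof.
elim: m f => [//|m IHm] f /=.
by congr (_ * _); apply: eq_bigr => a _; rewrite IHm.
Qed.

Lemma mean_take m n f : (m <= n)%N -> mean n (fun s => f (take m s)) = mean m f.
Proof.
move=> /subnKC <-; rewrite mean_cat; apply: eq_mean => s ss.
rewrite -[RHS](mean_cst (n - m)); apply: eq_mean => t _.
by rewrite take_size_cat.
Qed.

Lemma mean_drop m n f : (m <= n)%N ->
  mean n (fun s => f (drop m s)) = mean (n - m) f.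
Proof.
move=> mn; rewrite -{1}(subnKC mn) mean_cat.
rewrite -[RHS](mean_cst m); apply: eq_mean => s ss.
by apply: eq_mean => t _; rewrite drop_size_cat.
Qed.

(** The words which start with [u] bound the mean of a nonnegative function from
below, and their proportion is [#|A| ^- size u]. *)
Lemma mean_prefix u n f : (forall s, 0 <= f s) ->
  #|A|%:R^-1 ^+ size u * mean n (fun t => f (u ++ t)) <= mean (size u + n) f.
Proof.
elim: u f => [|a u IHu] f f0; first by rewrite expr0 mul1r.
rewrite addSn /= exprS -mulrA ler_wpM2l ?invr_ge0 ?ler0n //.
apply: le_trans (IHu (fun s => f (a :: s)) (fun s => f0 _)) _.
rewrite (bigD1 a) //= lerDl sumr_ge0 // => b _.
exact: mean_ge0.
Qed.

Lemma mean_tuple n f :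
  mean n f = #|A|%:R^-1 ^+ n * \sum_(t : n.-tuple A) f t.
Proof.
elim: n f => [|n IHn] f /=.
  rewrite expr0 mul1r (big_pred1 [tuple]) // => t.
  by apply/esym/eqP; rewrite tuple0.
rewrite exprS -mulrA; congr (_ * _).
rewrite (eq_bigr _ (fun a _ => IHn _)) -mulr_sumr; congr (_ * _).
rewrite pair_big /=.
rewrite (reindex (fun p : A * n.-tuple A => [tuple of p.1 :: p.2])) //=.
exists (fun t : n.+1.-tuple A => (thead t, [tuple of behead t])) => [[a t] _|t _] /=.
  by congr (_, _); apply: val_inj.
by rewrite -tuple_eta.
Qed.

End Mean.

(** The union bound. *)
Lemma has_le_sum (R : realFieldType) (T : Type) (p : pred T) (s : seq T) :
  (has p s)%:R <= \sum_(x <- s) (p x)%:R :> R.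
Proof.
elim: s => [|x s IHs] /=; first by rewrite big_nil.
rewrite big_cons; case: (p x) => /=; last by rewrite add0r.
by rewrite lerDl sumr_ge0 // => y _; rewrite ler0n.
Qed.

(** * Decay of the return probabilities *)

Lemma leq_bin_central m k : ('C(2 * m, k) <= 'C(2 * m, m))%N.
Proof.
wlog km : k / (k <= m)%N => [wlg|].
  have [/wlg//|mk] := leqP k m.
  have [k2m|k2m] := leqP k (2 * m); last by rewrite bin_small.
  by rewrite -bin_sub // wlg //; lia.
rewrite -(subKn km); elim: (m - k)%N (leq_subr k m) => [|j IHj] jm.
  by rewrite subn0.
apply: leq_trans (IHj (ltnW jm)).
set i := (m - j.+1)%N; have -> : (m - j = i.+1)%N by rewrite /i; lia.
have := mul_bin_left (2 * m) i.
have ile : (i.+1 <= 2 * m - i)%N by rewrite /i; lia.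
move=> binE; rewrite -(leq_pmul2l (ltn0Sn i)) binE leq_mul2r ile orbT //.
Qed.

(** That is, the walk on the line is at the origin after [2 * m] steps with
probability at most [(2 * m + 1) ^ (- 1 / 2)]. *)
Lemma bin_central_sqr m : ('C(2 * m, m) ^ 2 * (2 * m).+1 <= 16 ^ m)%N.
Proof.
elim: m => [//|m IHm].
have binS : (m.+1 * 'C(2 * m.+1, m.+1) = 2 * (2 * m).+1 * 'C(2 * m, m))%N.
  rewrite (_ : (2 * m.+1 = (2 * m).+2)%N); last by lia.
  have := mul_bin_diag (2 * m).+2 m; have := mul_bin_down (2 * m).+1 m.
  rewrite (_ : (2 * m).+1 - m = m.+1)%N /=; last by lia.
  by nia.
have m1 : (0 < m.+1 ^ 2)%N by [].
rewrite -(leq_pmul2l m1) mulnA -expnMn binS.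
rewrite expnMn -mulnA [X in (_ * X)%N]mulnC mulnA.
have -> : ((2 * (2 * m).+1) ^ 2 * (2 * m.+1).+1 * 'C(2 * m, m) ^ 2 =
  4 * ((2 * m).+1 * (2 * m).+3) * ('C(2 * m, m) ^ 2 * (2 * m).+1))%N.
  by rewrite -[(2 * m.+1).+1]/(_.+1) mulnS; nia.
apply: leq_trans (leq_mul (leqnn _) IHm) _.
by rewrite [(16 ^ m.+1)%N]expnS [leqRHS]mulnA leq_mul2r; apply/orP; right; nia.
Qed.

Section Walk1.
Variable R : rcfType.

(** Law of the simple random walk on the line. *)
Fixpoint law1 n (y : int) : R :=
  if n is m.+1 then 2^-1 * (law1 m (y - 1) + law1 m (y + 1)) else (y == 0)%:R.

Lemma law1_ge0 n y : 0 <= law1 n y.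
Proof.
by elim: n y => [|n IHn] y /=; rewrite ?ler0n // mulr_ge0 ?invr_ge0 ?addr_ge0.
Qed.

Lemma law1_le1 n y : law1 n y <= 1.
Proof.
elim: n y => [|n IHn] y /=; first by rewrite lern1 leq_b1.
by have := IHn (y - 1); have := IHn (y + 1); lra.
Qed.

(** Parity is part of the induction: it makes the missing neighbour vanish at the
end of the range. *)
Lemma law1_bin n : (forall k : nat,
    law1 n ((2 * k)%:Z - n%:Z) = 'C(n, k)%:R / 2 ^+ n) /\
  (forall y, (forall k : nat, y <> (2 * k)%:Z - n%:Z) -> law1 n y = 0).
Proof.
elim: n => [|n [IHk IHy]].
  split=> [k|y yk] /=.
    by rewrite expr0 divr1 bin0n; case: k => [|k]; rewrite //= subr0 mulrn_eq0.
  by case: eqP => // y0; case: (yk 0%N); rewrite y0.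
split=> [k|y yk] /=; last first.
  have -> : law1 n (y - 1) = 0 by apply: IHy => k yE; apply: (yk k.+1); lia.
  have -> : law1 n (y + 1) = 0 by apply: IHy => k yE; apply: (yk k); lia.
  by rewrite addr0 mulr0.
have -> : (2 * k)%:Z - n.+1%:Z + 1 = (2 * k)%:Z - n%:Z by lia.
rewrite IHk exprS invfM; case: k => [|k].
  rewrite IHy ?add0r ?bin0; last by move=> k; lia.
  by rewrite !mul1r.
have -> : (2 * k.+1)%:Z - n.+1%:Z - 1 = (2 * k)%:Z - n%:Z by lia.
by rewrite IHk binS natrD; ring.
Qed.

Lemma law1_even m y : law1 (2 * m) y <= 'C(2 * m, m)%:R / 4 ^+ m.
Proof.
have [law1k law1y] := law1_bin (2 * m).
have -> : 4 ^+ m = 2 ^+ (2 * m) :> R by rewrite exprM; congr (_ ^+ _); ring.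
have [y0|y0] := eqVneq (law1 (2 * m) y) 0.
  by rewrite y0 divr_ge0 ?ler0n ?exprn_ge0.
have [[k _ yE]|yE] : (exists2 k : nat, True & y = (2 * k)%:Z - (2 * m)%:Z) \/
    forall k : nat, y <> (2 * k)%:Z - (2 * m)%:Z.
  have [/eqP yk|yk] := boolP (y == (2 * `|y + (2 * m)%:Z|./2)%:Z - (2 * m)%:Z).
    by left; exists `|y + (2 * m)%:Z|./2.
  right=> k yE; move: yk; rewrite yE subrK (_ : `|(2 * k)%:Z|./2 = k) ?eqxx //.
  by rewrite absz_nat mul2n doubleK.
  by rewrite yE law1k ler_wpM2r ?ler_nat ?leq_bin_central // invr_ge0 exprn_ge0.
by rewrite law1y // eqxx in y0.
Qed.

Lemma bin_central_le m : ('C(2 * m, m)%:R / 4 ^+ m) ^+ 2 <= (2 * m).+1%:R^-1 :> R.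
Proof.
rewrite -[leRHS]mul1r ler_pdivlMr ?ltr0n // expr_div_n -exprM [(m * 2)%N]mulnC exprM.
rewrite mulrAC ler_pdivrMr ?exprn_gt0 // mul1r -natrX -natrM.
apply: le_trans (_ : (16 ^ m)%:R <= _); first by rewrite ler_nat bin_central_sqr.
by rewrite natrX lerXn2r ?nnegrE ?exprn_ge0 //; lra.
Qed.

(** For an odd number of steps, average the bound for the previous even one. *)
Lemma law1_sqr n y : law1 n y ^+ 2 <= 2 / n.+1%:R.
Proof.
have even_case m : forall z, law1 (2 * m) z ^+ 2 <= (2 * m).+1%:R^-1.
  move=> z; apply: le_trans (bin_central_le m).
  by rewrite lerXn2r ?nnegrE ?law1_even ?law1_ge0 // divr_ge0 ?ler0n ?exprn_ge0.
rewrite -(odd_double_half n) -mul2n; case: (odd n) => /=; last first.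
  rewrite add0n; apply: le_trans (even_case _ _) _.
  by rewrite ler_peMl ?invr_ge0 ?ler0n // ler1n.
rewrite add1n; set m := (2 * _)%N.
have := even_case n./2 (y - 1); have := even_case n./2 (y + 1); rewrite -/m.
have := law1_ge0 m (y - 1); have := law1_ge0 m (y + 1).
move: (law1 m _) (law1 m _) => a b a0 b0 aS bS /=.
apply: le_trans (_ : m.+1%:R^-1 <= _).
  move: (_^-1) aS bS => t aS bS.
  have -> : (2^-1 * (a + b)) ^+ 2 = 2^-1 * (a ^+ 2 + b ^+ 2) - 4^-1 * (a - b) ^+ 2.
    by field.
  by have := sqr_ge0 (a - b); lra.
rewrite ler_pdivlMr ?ltr0n // mulrC ler_pdivrMr ?ltr0n //.
by rewrite -natrM ler_nat; lia.
Qed.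

End Walk1.

(** Moments of the number of occurrences of a letter in a uniform word. *)
Section Occurrences.
Variables (R : realFieldType) (d : nat).
Hypothesis d_gt0 : (0 < d)%N.
Variable i : 'I_d.

Let occ n (g : nat -> R) := mean n (fun D : seq 'I_d => g (count_mem i D)).

Let cardI : (0 < #|'I_d|)%N. Proof. by rewrite card_ord. Qed.

Let occS n g :
  occ n.+1 g = d%:R^-1 * (occ n (g \o S) + d.-1%:R * occ n g).
Proof.
rewrite /occ /= card_ord (bigD1 i) //= eqxx; congr (_ * (_ + _)).
rewrite (eq_bigr (fun=> occ n g)); last first.
  by move=> a ai; apply: eq_mean => // s _; rewrite (negPf ai).
by rewrite sumr_const cardC1 card_ord mulr_natl.
Qed.

Let occD n g h : occ n (fun N => g N + h N) = occ n g + occ n h.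
Proof. exact: meanD. Qed.

(** Size biasing: a marked occurrence can be at any of the [n.+1] places, and
removing it leaves a uniform word of length [n]. *)
Lemma occ_size_bias n g :
  occ n.+1 (fun N => N%:R * g N.-1) = n.+1%:R / d%:R * occ n g.
Proof.
elim: n g => [|n IHn] g; rewrite occS.
  by rewrite /occ /= !mul1r mul0r mulr0 addr0.
have -> : occ n.+1 ((fun N => N%:R * g N.-1) \o S) =
    occ n.+1 (fun N => N%:R * g N.-1.+1) + occ n.+1 g.
  rewrite -occD; apply: eq_mean => // s _ /=.
  by case: (count_mem i s) => [|N] /=; rewrite -natr1; ring.
rewrite (IHn (g \o S)) IHn [occ n.+1 g]occS.
have d0 : d%:R != 0 :> R by rewrite pnatr_eq0 -lt0n.
have -> : d%:R = d.-1%:R + 1 :> R by rewrite natr1 prednK.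
rewrite -(prednK d_gt0) -natr1 in d0.
by rewrite -[n.+2%:R]natr1; field.
Qed.

(** The inverse rising factorials are the functions which size biasing maps to
one another. *)
Lemma occ_inv_rising n k :
  occ n (fun N => N`!%:R / (N + k)`!%:R) <=
  d%:R ^+ k * n`!%:R / (n + k)`!%:R.
Proof.
have fact0 m : m`!%:R != 0 :> R by rewrite pnatr_eq0 -lt0n fact_gt0.
elim: k n => [|k IHk] n.
  rewrite addn0 expr0 mul1r divff // -[leRHS](mean_cst cardI n (1 : R)).
  by apply: le_mean => // s _; rewrite addn0 divff.
have dn0 : 0 < d%:R / n.+1%:R :> R by rewrite divr_gt0 ?ltr0n.
have -> : occ n (fun N => N`!%:R / (N + k.+1)`!%:R) = d%:R / n.+1%:R *
    occ n.+1 (fun N => N%:R * (N.-1`!%:R / (N.-1 + k.+1)`!%:R)).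
  rewrite (occ_size_bias n (fun N => N`!%:R / (N + k.+1)`!%:R)) mulrA.
  by rewrite mulf_div mulrC [X in _ / X]mulrC divff ?mulr1 // mulf_neq0 ?pnatr_eq0 -?lt0n.
apply: (@le_trans _ _ (d%:R / n.+1%:R *
    occ n.+1 (fun N => N`!%:R / (N + k)`!%:R))).
  rewrite ler_pM2l //; apply: le_mean => // s _; case: (count_mem i s) => [|N] /=.
    by rewrite mul0r divr_ge0 ?ler0n.
  by rewrite mulrA -natrM -factS addnS addSn.
apply: le_trans (_ : d%:R / n.+1%:R *
   (d%:R ^+ k * n.+1`!%:R / (n.+1 + k)`!%:R) <= _).
  by rewrite ler_pM2l.
rewrite addnS addSn exprS factS natrM.
rewrite le_eqVlt; apply/orP; left; apply/eqP.
by field; rewrite fact0 nat1r pnatr_eq0.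
Qed.

End Occurrences.

Section Decay.
Variable R : rcfType.

(** The rate [n ^ (- 5 / 2)] of the heat kernel in dimension five. *)
Definition decay n : R := (n.+1%:R ^+ 2 * Num.sqrt n.+1%:R)^-1.

Lemma decay_ge0 n : 0 <= decay n.
Proof. by rewrite invr_ge0 mulr_ge0 ?exprn_ge0 ?sqrtr_ge0 ?ler0n. Qed.

Lemma decay_half m n : (n.+1 <= 2 * m.+1)%N -> decay m <= 8 * decay n.
Proof.
move=> nm; rewrite /decay -[8]invrK -invfM.
have sqrtS_gt0 k : 0 < Num.sqrt k.+1%:R :> R by rewrite sqrtr_gt0 ltr0n.
have den_gt0 k : 0 < k.+1%:R ^+ 2 * Num.sqrt k.+1%:R :> R.
  by rewrite mulr_gt0 ?exprn_gt0 ?ltr0n.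
rewrite lef_pV2 ?posrE ?mulr_gt0 ?invr_gt0 //.
have nmR : n.+1%:R <= 2 * m.+1%:R :> R by rewrite -natrM ler_nat.
have sqrt_le : Num.sqrt n.+1%:R <= 2 * Num.sqrt m.+1%:R :> R.
  rewrite -[2 in leRHS](@ger0_norm R) // -sqrtr_sqr -sqrtrM ?sqr_ge0 //.
  rewrite ler_sqrt ?mulr_ge0 ?sqr_ge0 ?ler0n // (le_trans nmR) //.
  by rewrite ler_wpM2r ?ler0n //; lra.
have : n.+1%:R ^+ 2 * Num.sqrt n.+1%:R <= 
       (2 * m.+1%:R) ^+ 2 * (2 * Num.sqrt m.+1%:R) :> R.
  by rewrite ler_pM ?exprn_ge0 ?sqrtr_ge0 ?ler0n // lerXn2r ?nnegrE ?mulr_ge0 ?ler0n.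
by rewrite exprMn; lra.
Qed.

(** This is where five dimensions are needed: [c - 1] pairs have sum [c], and
[c * decay c] is summable. With [a] and [b] the distances in time from the
present to a past and to a future time, the sum bounds, up to a constant, the
probability that the past and the future come near each other at times more than
[l] apart. *)
Lemma double_sum_decay l p q :
  \sum_(1 <= a < p.+1) \sum_(1 <= b < q.+1) (l < a + b)%N%:R * decay (a + b)
  <= 2 / Num.sqrt l.+1%:R.
Proof.
pose F c : R := (l < c)%N%:R * decay c.
have F0 c : 0 <= F c by rewrite mulr_ge0 ?decay_ge0.
have sumF0 (r : seq nat) h k : (forall i, 0 <= h i) ->
    0 <= \sum_(i <- r) h i * F (k i) by move=> h0; apply: sumr_ge0 => *; rewrite mulr_ge0.
have sumF0' (r : seq nat) k : 0 <= \sum_(i <- r) F (k i).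
  by apply: sumr_ge0 => *; apply: F0.
apply: (@le_trans _ _ (\sum_(0 <= a < p.+1) \sum_(0 <= b < q.+1) F (a + b)%N)).
  rewrite [leRHS]big_ltn // ler_wpDl // ler_sum // => a _.
  by rewrite [leRHS]big_ltn // ler_wpDl.
pose m := (p.+1 + q.+1)%N.
apply: (@le_trans _ _ (\sum_(0 <= a < p.+1) \sum_(0 <= c < m) (a <= c)%N%:R * F c)).
  rewrite big_seq [leRHS]big_seq; apply: ler_sum => a; rewrite mem_index_iota => ap.
  rewrite [leRHS](big_cat_nat (n := a)) //=; last by rewrite /m; lia.
  rewrite ler_wpDl ?sumF0 //.
  rewrite [leRHS](big_cat_nat (n := a + q.+1)) /= ?leq_addr //; last first.
    by rewrite /m; lia.
  rewrite ler_wpDr ?sumF0 //.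
  rewrite -{2}[a]add0n big_addn addKn; apply: ler_sum => b _.
  by rewrite leq_addl mul1r addnC.
rewrite exchange_big /=.
pose T c : R := 2 / Num.sqrt (maxn c l.+1)%:R.
apply: (@le_trans _ _ (\sum_(0 <= c < m) (T c - T c.+1))); last first.
  rewrite (@telescope_sumr_eq _ _ _ (fun k => - T k)) // => [|k _]; last first.
    by rewrite opprK addrC.
  by rewrite opprK /T max0n addrC gerBl divr_ge0 ?sqrtr_ge0.
apply: ler_sum => c _; rewrite -mulr_suml.
apply: (@le_trans _ _ (c.+1%:R * F c)).
  rewrite ler_wpM2r // -natr_sum ler_nat.
  have -> : (\sum_(0 <= a < p.+1) (a <= c) = minn p.+1 c.+1)%N; last exact: geq_minr.
  elim: p.+1 => [|k IHk]; first by rewrite big_geq // min0n.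
  by rewrite big_nat_recr //= IHk; lia.
rewrite /F /T; have [lc|cl] := ltnP l c; last first.
  rewrite mul0r mulr0 (_ : maxn c l.+1 = l.+1); last by lia.
  by rewrite (_ : maxn c.+1 l.+1 = l.+1) ?subrr; last by lia.
rewrite (_ : maxn c l.+1 = c); last by lia.
rewrite (_ : maxn c.+1 l.+1 = c.+1); last by lia.
rewrite mul1r /decay.
have c0 : 0 < c%:R :> R by rewrite ltr0n; lia.
have : c%:R <= c.+1%:R :> R by rewrite ler_nat.
have : c.+1%:R = c%:R + 1 :> R by rewrite natr1.
have : 0 < Num.sqrt c%:R :> R by rewrite sqrtr_gt0.
have : 0 < Num.sqrt c.+1%:R :> R by rewrite sqrtr_gt0 ltr0n.
have := sqr_sqrtr (ler0n R c); have := sqr_sqrtr (ler0n R c.+1).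
move: (Num.sqrt c%:R) (Num.sqrt c.+1%:R) => u v vE uE v0 u0 SE _.
rewrite -uE in c0; rewrite -vE -uE in SE *.
have uv : u <= v by rewrite -(@ler_pXn2r _ 2) ?nnegrE ?ltW //; lra.
have -> : v ^+ 2 * ((v ^+ 2) ^+ 2 * v)^-1 = (v ^+ 3)^-1 by field; rewrite gt_eqF.
have -> : 2 / u - 2 / v = 2 * ((v ^+ 2 - u ^+ 2) / (u * v * (u + v))).
  by field; rewrite !gt_eqF // addr_gt0.
have -> : v ^+ 2 - u ^+ 2 = 1 by rewrite SE addrC addKr.
have uv_gt0 : 0 < u * v * (u + v) by rewrite !mulr_gt0 // addr_gt0.
rewrite mul1r -[2]invrK -invfM lef_pV2 ?posrE ?mulr_gt0 ?addr_gt0 ?invr_gt0 ?exprn_gt0 //.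
rewrite mulrC ler_pdivrMr //.
have : u * v * (u + v) <= v * v * (v + v).
  have [u0' v0'] := (ltW u0, ltW v0).
  have uvv : u * v <= v * v by rewrite ler_wpM2r.
  by apply: ler_pM; rewrite ?mulr_ge0 ?addr_ge0 ?lerD2r.
by rewrite -!expr2 !exprS; lra.
Qed.

End Decay.

Section Steps.
Variable d : nat.

Definition dir : finType := ('I_d * bool)%type.

Definition step (a : dir) : 'rV[int]_d :=
  \row_j (if j == a.1 then (if a.2 then 1 else -1) else 0).

Definition pos (w : seq dir) : 'rV[int]_d := \sum_(a <- w) step a.

Definition norm1 (z : 'rV[int]_d) : nat := (\sum_(j < d) `|z 0%R j|)%N.

Lemma pos_nil : pos [::] = 0.
Proof. by rewrite /pos big_nil. Qed.

Lemma pos_cons a w : pos (a :: w) = step a + pos w.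
Proof. by rewrite /pos big_cons. Qed.

Lemma pos_cat s t : pos (s ++ t) = pos s + pos t.
Proof. by rewrite /pos big_cat. Qed.

Lemma pos_nseq n a : pos (nseq n a) = step a *+ n.
Proof. by elim: n => [|n IHn] /=; rewrite ?pos_nil // pos_cons IHn mulrS. Qed.

Lemma norm1D x y : (norm1 (x + y) <= norm1 x + norm1 y)%N.
Proof.
rewrite /norm1 -big_split /=; apply: leq_sum => j _; rewrite mxE.
by move: (x _ j) (y _ j) => a b; lia.
Qed.

Lemma norm1N x : norm1 (- x) = norm1 x.
Proof. by apply: eq_bigr => j _; rewrite mxE abszN. Qed.

Lemma norm1_0 : norm1 0 = 0%N.
Proof. by rewrite /norm1 big1 // => j _; rewrite mxE. Qed.

Lemma norm1_eq0 x : norm1 x = 0%N -> x = 0.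
Proof.
move/eqP; rewrite sum_nat_eq0 => /forallP x0; apply/rowP => j.
by move: (x0 j); rewrite mxE => /eqP; lia.
Qed.

Lemma norm1_stepMn a n : norm1 (step a *+ n) = n.
Proof.
rewrite /norm1 (bigD1 a.1) //= big1 ?addn0.
  by rewrite mulmxnE mxE eqxx; case: a.2; lia.
by move=> j /negPf ja; rewrite mulmxnE mxE ja mul0rn.
Qed.

Lemma norm1_step a : norm1 (step a) = 1%N.
Proof. exact: (norm1_stepMn a 1). Qed.

Lemma norm1_pos w : (norm1 (pos w) <= size w)%N.
Proof.
elim: w => [|a w IHw]; first by rewrite pos_nil norm1_0.
by rewrite pos_cons (leq_trans (norm1D _ _)) // norm1_step ltnS.
Qed.

Lemma norm1_eq1 z : norm1 z = 1%N -> exists a : dir, z = step a.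
Proof.
move/eqP/sum_nat_eq1 => [i [_ zi z0]]; exists (i, 0 <= z 0 i).
apply/rowP => j; rewrite mxE /=; case: eqP => [->|/eqP ji].
  by move: zi; case: (lerP 0 (z 0 i)); lia.
by apply/eqP; rewrite -absz_eq0 z0.
Qed.

End Steps.

Section HeatKernel.
Variables (R : rcfType) (d : nat).

Lemma card_dir : #|dir d| = (2 * d)%N.
Proof. by rewrite card_prod card_ord card_bool mulnC. Qed.

Lemma card_dir_gt0 : (0 < d)%N -> (0 < #|dir d|)%N.
Proof. by rewrite card_dir muln_gt0. Qed.

(** Conditionally on the coordinate which moves at each step, the coordinates are
independent simple random walks on the line. *)
Lemma pos_law n x :
  mean n (fun w : seq (dir d) => (pos w == x)%:R) =
  mean n (fun D : seq 'I_d => \prod_(i < d) law1 R (count_mem i D) (x 0 i)).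
Proof.
elim: n x => [|n IHn] x /=.
  rewrite pos_nil eq_sym; have [->|x0] := eqVneq x 0.
    by rewrite big1 // => i _; rewrite mxE eqxx.
  have [i xi] : exists i, x 0 i != 0.
    apply/existsP; apply: contraNT x0 => /existsPn x0; apply/eqP/rowP => i.
    by rewrite mxE; apply/eqP/negbNE/x0.
  by rewrite (bigD1 i) //= (negPf xi) mul0r.
rewrite card_dir card_ord natrM invfM [2^-1 * _]mulrC -mulrA; congr (_ * _).
have -> : \sum_(a : dir d) mean n (fun s => (pos (a :: s) == x)%:R) =
    \sum_(i < d) \sum_(b : bool)
      mean n (fun s : seq (dir d) => (pos (((i, b) : dir d) :: s) == x)%:R) :> R.
  by rewrite pair_bigA; apply: eq_bigr => -[].
rewrite mulr_sumr; apply: eq_bigr => i _.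
rewrite big_bool /=.
have shiftE b : mean n (fun s => (pos (((i, b) : dir d) :: s) == x)%:R) =
    mean n (fun D : seq 'I_d => law1 R (count_mem i D)
        (x 0 i - (if b then 1 else -1)) *
      \prod_(j < d | j != i) law1 R (count_mem j D) (x 0 j)).
  have -> : mean n (fun s => (pos (((i, b) : dir d) :: s) == x)%:R) =
      mean n (fun s => (pos s == x - step (i, b))%:R) :> R.
    apply: eq_mean.
    by move=> s _; rewrite [pos s == _]eq_sym subr_eq [x == _]eq_sym addrC pos_cons.
  rewrite IHn; apply: eq_mean.
  move=> D _; rewrite (bigD1 i) //= !mxE eqxx; congr (_ * _).
  by apply: eq_bigr => j /negPf ji; rewrite !mxE /= ji subr0.
rewrite !shiftE -meanD -meanZ; apply: eq_mean.
move=> D _; rewrite [RHS](bigD1 i) //= eqxx opprK.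
  by rewrite -mulrDl mulrA; congr (_ * _);
    apply: eq_bigr => j; rewrite eq_sym => /negPf ->.
Qed.

Hypothesis d_ge5 : (5 <= d)%N.
Let d_gt0 : (0 < d)%N. Proof. exact: leq_trans d_ge5. Qed.

(** Four of the five factors use [law1_sqr] in pairs. The last one leaves a
square root of [N], which is bounded by that of [n] so that only inverse
rising factorials of [N] have to be averaged. *)
Lemma law1_pow5 n N y : (N <= n)%N ->
  law1 R N y ^+ 5 <= 48 * Num.sqrt n.+1%:R * (N`!%:R / (N + 3)`!%:R).
Proof.
move=> Nn; set b := law1 R N y; have b0 : 0 <= b by apply: law1_ge0.
have b2 : b ^+ 2 <= 2 / N.+1%:R by apply: law1_sqr.
have M0 : 0 < N.+1%:R :> R by rewrite ltr0n.
have sqrt_le : Num.sqrt N.+1%:R <= Num.sqrt n.+1%:R :> R.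
  by rewrite ler_sqrt ?ler_nat ?ler0n.
have b1 : b <= 2 * Num.sqrt n.+1%:R / N.+1%:R.
  apply: le_trans (_ : 2 * Num.sqrt N.+1%:R / N.+1%:R <= _); last first.
    by rewrite ler_wpM2r ?invr_ge0 ?ler0n // ler_wpM2l.
  rewrite -(@ler_pXn2r _ 2) ?nnegrE ?divr_ge0 ?mulr_ge0 ?sqrtr_ge0 //.
  apply: le_trans b2 _; rewrite expr_div_n exprMn sqr_sqrtr ?ler0n //.
  by rewrite expr2 invfM mulrA mulfK ?gt_eqF // ler_wpM2r ?invr_ge0 ?ler0n //; lra.
apply: le_trans (_ : (2 / N.+1%:R) ^+ 2 * (2 * Num.sqrt n.+1%:R / N.+1%:R) <= _).
  rewrite -[5%N]/(2 * 2 + 1)%N exprD exprM expr1.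
  by rewrite ler_pM ?exprn_ge0 // lerXn2r ?nnegrE ?exprn_ge0 ?divr_ge0 ?ler0n.
have -> : (2 / N.+1%:R) ^+ 2 * (2 * Num.sqrt n.+1%:R / N.+1%:R) =
    48 * Num.sqrt n.+1%:R * (6 * N.+1%:R ^+ 3)^-1 :> R.
  by field; rewrite addrC natr1 pnatr_eq0.
rewrite ler_wpM2l ?mulr_ge0 ?sqrtr_ge0 //.
rewrite ler_pdivlMr ?ltr0n ?fact_gt0 // mulrC ler_pdivrMr ?mulr_gt0 ?exprn_gt0 //.
rewrite -natrX -!natrM ler_nat addn3 !factS; nia.
Qed.

(** The largest factor dominates the product of [d >= 5] numbers of [0, 1], so
that only the occurrences of one coordinate matter. *)
Lemma return_bound n x :
  mean n (fun w : seq (dir d) => (pos w == x)%:R) <= 48 * d%:R ^+ 4 * decay R n.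
Proof.
rewrite pos_law.
apply: (@le_trans _ _ (mean n (fun D : seq 'I_d => \sum_(i < d)
    48 * Num.sqrt n.+1%:R * ((count_mem i D)`!%:R / (count_mem i D + 3)`!%:R)))).
  apply: le_mean => D sD.
  pose b i := law1 R (count_mem i D) (x 0 i).
  have b01 i : 0 <= b i <= 1 by rewrite law1_ge0 law1_le1.
  pose m := [arg max_(i > Ordinal d_gt0) b i]%O.
  have b_le i : b i <= b m.
    by rewrite /m; case: Order.TotalTheory.arg_maxP => // j _; apply.
  apply: (@le_trans _ _ (b m ^+ d)).
    rewrite -[in leRHS](card_ord d) -prodr_const.
    by apply: ler_prod => i _; rewrite b_le andbT; case/andP: (b01 i).
  rewrite (bigD1 m) //=; apply: ler_wpDr.
    by apply: sumr_ge0 => i _; rewrite !mulr_ge0 ?sqrtr_ge0 ?invr_ge0 ?ler0n.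
  apply: le_trans (law1_pow5 (x 0 m) _); last by rewrite -sD count_size.
  by have /andP[? ?] := b01 m; rewrite ler_wiXn2l.
rewrite mean_sum ?card_ord //; apply: (@le_trans _ _ (\sum_(i < d)
   48 * Num.sqrt n.+1%:R * (d%:R ^+ 3 * n`!%:R / (n + 3)`!%:R))).
  apply: ler_sum => i _; rewrite meanZ ler_wpM2l ?mulr_ge0 ?sqrtr_ge0 //.
  exact: occ_inv_rising.
rewrite sumr_const card_ord -[leLHS]mulr_natl.
have n1 : 0 < n.+1%:R :> R by rewrite ltr0n.
have sqrt_gt0 : 0 < Num.sqrt n.+1%:R :> R by rewrite sqrtr_gt0.
have -> : decay R n = Num.sqrt n.+1%:R / n.+1%:R ^+ 3.
  rewrite /decay [X in _ = _ / X]exprSr -[X in _ = _ / (_ * X)]sqr_sqrtr ?ler0n //.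
  by field; rewrite !gt_eqF // addrC natr1.
have -> : d%:R * (48 * Num.sqrt n.+1%:R * (d%:R ^+ 3 * n`!%:R / (n + 3)`!%:R)) =
    48 * d%:R ^+ 4 * (Num.sqrt n.+1%:R * (n`!%:R / (n + 3)`!%:R)) :> R.
  by field; rewrite pnatr_eq0 -lt0n fact_gt0.
rewrite ler_wpM2l ?mulr_ge0 ?exprn_ge0 ?ler0n // ler_wpM2l ?sqrtr_ge0 //.
rewrite -[leRHS]mul1r ler_pdivlMr ?exprn_gt0 // mulrAC.
rewrite ler_pdivrMr ?ltr0n ?fact_gt0 // mul1r.
by rewrite -natrX -natrM ler_nat addn3 !factS; nia.
Qed.

(** Points at distance at most one are the [2 * d + 1] translates by a step or
by zero. *)
Lemma near_bound n x :
  mean n (fun w : seq (dir d) => (norm1 (pos w + x) <= 1)%N%:R) <=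
  (2 * d).+1%:R * (48 * d%:R ^+ 4) * decay R n.
Proof.
apply: (@le_trans _ _ (mean n (fun w : seq (dir d) => (pos w == - x)%:R +
    \sum_(a : dir d) (pos w == step a - x)%:R))).
  apply: le_mean => w _; case: leqP => [le1|_] /=; last first.
    by rewrite addr_ge0 ?ler0n // sumr_ge0.
  have [/eqP|] := boolP (norm1 (pos w + x) == 0%N).
    move/norm1_eq0/eqP; rewrite addr_eq0 => ->.
    by rewrite lerDl sumr_ge0.
  move=> n0; have /norm1_eq1[a aE] : norm1 (pos w + x) = 1%N by lia.
  rewrite (bigD1 a) //= -aE addrK eqxx.
  rewrite addrCA lerDl addr_ge0 ?ler0n // sumr_ge0 //.
set K := 48 * _; rewrite meanD mean_sum ?card_dir_gt0 // -[(2 * d).+1]addn1 natrD.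
rewrite 2!mulrDl mul1r addrC.
apply: lerD; last exact: return_bound.
apply: le_trans (ler_sum _ (fun a _ => return_bound n (step a - x))) _.
by rewrite sumr_const card_dir -[leLHS]mulr_natl mulrA.
Qed.

(** The factor [8] comes from [decay_half]. *)
Definition pair_cst : R := 8 * ((2 * d).+1%:R * (48 * d%:R ^+ 4)).

Lemma pair_cst_gt0 : 0 < pair_cst.
Proof. by rewrite !mulr_gt0 ?exprn_gt0 ?ltr0n. Qed.

(** A free walk of [f] steps cannot undo more than [f] straight steps, up to
nearness. So [f] is at least about half of the total number [f + m] of steps,
and the bound can be stated in terms of the latter. *)
Lemma straight_near_bound f m a :
  mean f (fun w : seq (dir d) => (norm1 (pos w + step a *+ m) <= 1)%N%:R) <=
  (m <= f.+1)%N%:R * (pair_cst * decay R (f + m)).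
Proof.
have [mf|fm] := leqP m f.+1; last first.
  rewrite mul0r -(mean_cst (card_dir_gt0 d_gt0) f (0 : R)); apply: le_mean => w sw.
  case: leqP => // le1; have := norm1D (pos w + step a *+ m) (- pos w).
  rewrite addrAC subrr add0r norm1_stepMn norm1N.
  by have := norm1_pos w; rewrite sw; lia.
rewrite mul1r; apply: le_trans (near_bound _ _) _.
rewrite /pair_cst; set K := _.+1%:R * _; rewrite [8 * K]mulrC -[leRHS]mulrA ler_wpM2l //.
  by rewrite !mulr_ge0 ?exprn_ge0.
by apply: decay_half; lia.
Qed.

End HeatKernel.

(** * Cut times have positive density *)

Section Lastn.
Variable T : Type.
Implicit Types s t : seq T.

Definition lastn a s := drop (size s - a) s.

Lemma lastn0 s : lastn 0 s = [::].
Proof. by rewrite /lastn subn0 drop_size. Qed.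

Lemma lastn_lastn a b s : (a <= b <= size s)%N -> lastn a (lastn b s) = lastn a s.
Proof.
move=> abs; rewrite /lastn size_drop drop_drop; congr drop; lia.
Qed.

Lemma size_lastn a s : size (lastn a s) = minn a (size s).
Proof. by rewrite /lastn size_drop; lia. Qed.

Lemma lastn_cat_nseq a s n (x : T) :
  lastn a (s ++ nseq n x) = lastn (a - n) s ++ nseq (minn a n) x.
Proof.
rewrite /lastn size_cat size_nseq drop_cat; case: ltnP => an.
  by congr (drop _ _ ++ nseq _ _); lia.
rewrite drop_nseq [in RHS]drop_oversize; last lia.
by congr nseq; lia.
Qed.

Lemma lastn_take a j s : (a <= j <= size s)%N ->
  lastn a (take j s) = take a (drop (j - a) s).
Proof.
move=> ajs; rewrite /lastn size_takel; last lia.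
by rewrite take_drop subnKC //; lia.
Qed.

Lemma take_nseq_cat b n (x : T) t :
  take b (nseq n x ++ t) = nseq (minn b n) x ++ take (b - n) t.
Proof.
rewrite take_cat size_nseq; case: ltnP => bn.
  rewrite (_ : b - n = 0)%N ?take0 ?cats0; last lia.
  by rewrite take_nseq // ltnW.
by [].
Qed.

End Lastn.

Section StraightCut.
Variables (R : rcfType) (d : nat).
Hypothesis d_ge5 : (5 <= d)%N.
Let d_gt0 : (0 < d)%N. Proof. exact: leq_trans d_ge5. Qed.
Variable e : dir d.

(** The present lies between [s] and [t]; [a] and [b] count the steps back and
forth from it. *)
Definition touch (s t : seq (dir d)) (a b : nat) : bool :=
  (norm1 (pos (lastn a s) + pos (take b t)) <= 1)%N.

Definition touch_line (t : seq (dir d)) (i b : nat) : bool :=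
  (norm1 (step e *+ i + pos (take b t)) <= 1)%N.

(** The cut times which are counted, for a walk with past [s] and future [t]. The
straight steps around the present make them likely, and the last condition
leaves room for a straight path of [J] steps in place of the past. *)
Definition straight_cut (L J : nat) (s t : seq (dir d)) : bool :=
  [&& lastn L s == nseq L e, take L t == nseq L e,
   ~~ has (fun a => has (touch s t a) (iota 1 (size t))) (iota 1 (size s)) &
   ~~ has (fun i => has (touch_line t i) (iota 1 (size t))) (iota 1 J)].

Let cst := pair_cst R d.

Lemma mean_lastn n p (f : seq (dir d) -> R) : (n <= p)%N ->
  mean p (fun s => f (lastn n s)) = mean n f.
Proof.
move=> np; rewrite -[in RHS](subKn np) -mean_drop ?leq_subr //; last first.
  exact: card_dir_gt0.
by apply: eq_mean => s <-.
Qed.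

(** If [a + b <= 2 * L], then the free steps between the two points are too few to
undo the straight ones. *)
Lemma mean_touch L p q a b : (0 < a <= p + L)%N -> (0 < b <= L + q)%N ->
  mean p (fun s => mean q (fun t =>
    (touch (s ++ nseq L e) (nseq L e ++ t) a b)%:R)) <=
  cst * ((2 * L < a + b)%N%:R * decay R (a + b)).
Proof.
move=> ap bq; pose m := (minn a L + minn b L)%N.
pose F w : R := (norm1 (pos w + step e *+ m) <= 1)%N%:R.
have -> : mean p (fun s => mean q (fun t =>
      (touch (s ++ nseq L e) (nseq L e ++ t) a b)%:R)) =
    mean p (fun s => mean q (fun t => F (lastn (a - L) s ++ take (b - L) t))).
  apply: eq_mean => s _; apply: eq_mean => t _; congr (_%:R).
  congr (norm1 _ <= 1)%N.
  rewrite lastn_cat_nseq take_nseq_cat /m mulrnDr !pos_cat !pos_nseq.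
  by rewrite [RHS]addrACA [in RHS](addrC (pos (take _ _))).
rewrite (mean_lastn (fun s => mean q (fun t => F (s ++ take (b - L) t)))); last lia.
rewrite (eq_mean (g := fun s => mean (b - L) (fun t => F (s ++ t)))); last first.
  by move=> s _; rewrite (mean_take _ (fun t => F (s ++ t))) ?card_dir_gt0 //; lia.
rewrite -mean_cat; apply: le_trans (straight_near_bound R d_ge5 _ _ _) _.
rewrite mulrCA ler_wpM2l ?(ltW (pair_cst_gt0 R d_ge5)) //.
have -> : (a - L + (b - L) + m = a + b)%N by rewrite /m; lia.
rewrite ler_wpM2r ?decay_ge0 // ler_nat.
have [mle|//] := leqP m (a - L + (b - L)).+1.
by rewrite lt0b; rewrite /m in mle; lia.
Qed.

Lemma mean_touch_line L q i b : (0 < i)%N -> (0 < b <= L + q)%N ->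
  mean q (fun t => (touch_line (nseq L e ++ t) i b)%:R) <=
  cst * ((2 * L < i + b)%N%:R * decay R (i + b)).
Proof.
move=> i0 bq; pose m := (i + minn b L)%N.
pose F w : R := (norm1 (pos w + step e *+ m) <= 1)%N%:R.
have -> : mean q (fun t => (touch_line (nseq L e ++ t) i b)%:R) =
    mean q (fun t => F (take (b - L) t)).
  apply: eq_mean => t _; congr (_%:R).
  by rewrite /touch_line take_nseq_cat /m mulrnDr pos_cat pos_nseq addrA addrC.
rewrite mean_take ?card_dir_gt0 //; last lia.
apply: le_trans (straight_near_bound R d_ge5 _ _ _) _.
rewrite mulrCA ler_wpM2l ?(ltW (pair_cst_gt0 R d_ge5)) //.
have -> : (b - L + m = i + b)%N by rewrite /m; lia.
rewrite ler_wpM2r ?decay_ge0 // ler_nat.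
have [mle|//] := leqP m (b - L).+1.
by rewrite lt0b; rewrite /m in mle; lia.
Qed.

(** Only contacts between times more than [l] apart are counted, because those
are the ones which a local cut time does not exclude. *)
Definition touches l (s t : seq (dir d)) : R :=
  \sum_(1 <= a < (size s).+1) \sum_(1 <= b < (size t).+1)
     (l < a + b)%N%:R * (touch s t a b)%:R.

Definition touches_line l J (t : seq (dir d)) : R :=
  \sum_(1 <= i < J.+1) \sum_(1 <= b < (size t).+1)
     (l < i + b)%N%:R * (touch_line t i b)%:R.

Let tail l : R := cst * (2 / Num.sqrt l.+1%:R).

Let double_sum_le l L p q :
  \sum_(1 <= a < p.+1) \sum_(1 <= b < q.+1)
     (l < a + b)%N%:R * (cst * ((2 * L < a + b)%N%:R * decay R (a + b)))
  <= tail (maxn l (2 * L)).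
Proof.
apply: le_trans (ler_wpM2l (ltW (pair_cst_gt0 R d_ge5))
  (double_sum_decay R (maxn l (2 * L)) p q)).
rewrite mulr_sumr; apply: ler_sum => a _.
rewrite mulr_sumr; apply: ler_sum => b _.
by rewrite mulrCA [X in _ * X <= _]mulrA -natrM mulnb -gtn_max.
Qed.

Lemma mean_touches l L p q :
  mean p (fun s => mean q (fun t =>
    touches l (s ++ nseq L e) (nseq L e ++ t))) <= tail (maxn l (2 * L)).
Proof.
have cardD := card_dir_gt0 d_gt0.
apply: le_trans (double_sum_le l L (p + L) (L + q)).
pose T a b s t : R := (touch (s ++ nseq L e) (nseq L e ++ t) a b)%:R.
have -> : mean p (fun s => mean q (fun t =>
      touches l (s ++ nseq L e) (nseq L e ++ t))) =
    \sum_(1 <= a < (p + L).+1) \sum_(1 <= b < (L + q).+1)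
      (l < a + b)%N%:R * mean p (fun s => mean q (fun t => T a b s t)).
  transitivity (mean p (fun s => \sum_(1 <= a < (p + L).+1)
      \sum_(1 <= b < (L + q).+1) (l < a + b)%N%:R * mean q (T a b s))).
    apply: eq_mean => s ss.
    rewrite (eq_mean (g := fun t => \sum_(1 <= a < (p + L).+1)
      \sum_(1 <= b < (L + q).+1) (l < a + b)%N%:R * T a b s t)); last first.
      by move=> t st; rewrite /touches !size_cat size_nseq ss st.
    rewrite mean_sum //; apply: eq_bigr => a _.
    by rewrite mean_sum //; apply: eq_bigr => b _; rewrite meanZ.
  rewrite mean_sum //; apply: eq_bigr => a _.
  by rewrite mean_sum //; apply: eq_bigr => b _; rewrite meanZ.
rewrite big_seq [leRHS]big_seq; apply: ler_sum => a.
rewrite mem_index_iota => ap; rewrite big_seq [leRHS]big_seq.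
apply: ler_sum => b; rewrite mem_index_iota => bq.
by rewrite ler_wpM2l // mean_touch.
Qed.

Lemma mean_touches_line l L J q :
  mean q (fun t => touches_line l J (nseq L e ++ t)) <= tail (maxn l (2 * L)).
Proof.
have cardD := card_dir_gt0 d_gt0.
apply: le_trans (double_sum_le l L J (L + q)).
rewrite (eq_mean (g := fun t => \sum_(1 <= i < J.+1)
    \sum_(1 <= b < (L + q).+1) (l < i + b)%N%:R *
      (touch_line (nseq L e ++ t) i b)%:R)); last first.
  by move=> t st; rewrite /touches_line size_cat size_nseq st.
rewrite mean_sum // big_seq [leRHS]big_seq; apply: ler_sum => i.
rewrite mem_index_iota => ip.
rewrite mean_sum // big_seq [leRHS]big_seq; apply: ler_sum => b.
rewrite mem_index_iota => bq.
rewrite meanZ ler_wpM2l // mean_touch_line //; lia.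
Qed.

Lemma has_touch_le_touches s t :
  (has (fun a => has (touch s t a) (iota 1 (size t))) (iota 1 (size s)))%:R
  <= touches 0 s t.
Proof.
apply: le_trans (has_le_sum _ _ _) _.
rewrite /touches /index_iota !subSS !subn0 big_seq [leRHS]big_seq.
apply: ler_sum => a; rewrite mem_iota => ap.
apply: le_trans (has_le_sum _ _ _) _.
apply: ler_sum => b _.
by rewrite (_ : (0 < a + b)%N) ?mul1r //; lia.
Qed.

Lemma has_touch_line_le_touches_line J t :
  (has (fun i => has (touch_line t i) (iota 1 (size t))) (iota 1 J))%:R
  <= touches_line 0 J t.
Proof.
apply: le_trans (has_le_sum _ _ _) _.
rewrite /touches_line /index_iota !subSS !subn0 big_seq [leRHS]big_seq.
apply: ler_sum => a; rewrite mem_iota => ap.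
apply: le_trans (has_le_sum _ _ _) _.
apply: ler_sum => b _.
by rewrite (_ : (0 < a + b)%N) ?mul1r //; lia.
Qed.

Definition density L : R := (2 * d)%:R^-1 ^+ (2 * L) / 2.

(** Given the [2 * L] straight steps, two times which are at most [2 * L] apart
are too close for the walk to come near itself, and the union bound over the
other pairs leaves a probability of at least one half. *)
Lemma straight_cut_ge L J p q : (L <= p)%N -> (L <= q)%N ->
  tail (2 * L) <= 4^-1 ->
  density L <= mean p (fun s => mean q (fun t => (straight_cut L J s t)%:R)).
Proof.
have cardD := card_dir_gt0 d_gt0.
move=> /subnK <- /subnKC <- tail_le; set p' := (p - L)%N; set q' := (q - L)%N.
have mean_word (f : seq (dir d) -> R) : (forall s, 0 <= f s) ->
    (2 * d)%:R^-1 ^+ L * f (nseq L e) <= mean L f.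
  move=> f0; have := mean_prefix cardD (nseq L e) 0 f0.
  by rewrite /= cats0 size_nseq addn0 card_dir.
pose U := nseq L e.
pose g s t : R := 1 - touches 0 (s ++ U) (U ++ t) - touches_line 0 J (U ++ t).
have cut_ge s t : g s t <= (straight_cut L J (s ++ U) (U ++ t))%:R.
  have := has_touch_le_touches (s ++ U) (U ++ t).
  have := has_touch_line_le_touches_line J (U ++ t).
  rewrite /g /straight_cut /U lastn_cat_nseq subnn lastn0 minnn eqxx.
  rewrite take_size_cat ?size_nseq // eqxx /=.
  by case: has; case: has => /=; lra.
rewrite mean_cat.
apply: (@le_trans _ _ (mean p' (fun s => (2 * d)%:R^-1 ^+ L *
    ((2 * d)%:R^-1 ^+ L * mean q' (g s))))); last first.
  apply: le_mean => s _.
  apply: le_trans (mean_word _ _); last first.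
    by move=> u; apply: mean_ge0 => // t _; rewrite ler0n.
  rewrite ler_wpM2l ?exprn_ge0 ?invr_ge0 // mean_cat.
  apply: le_trans (mean_word _ _); last first.
    by move=> u; apply: mean_ge0 => // t _; rewrite ler0n.
  rewrite ler_wpM2l ?exprn_ge0 ?invr_ge0 //; apply: le_mean => t _.
  exact: cut_ge.
rewrite !meanZ mulrA -exprD addnn -mul2n /density.
rewrite ler_wpM2l ?exprn_ge0 ?invr_ge0 //.
have -> : mean p' (fun s => mean q' (g s)) = 1 -
    mean p' (fun s => mean q' (fun t => touches 0 (s ++ U) (U ++ t))) -
    mean q' (fun t => touches_line 0 J (U ++ t)).
  rewrite -[1 in RHS](mean_cst cardD p') -meanB.
  rewrite -[X in _ = _ - X](mean_cst cardD p') -meanB.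
  apply: eq_mean => s _; rewrite !meanB mean_cst //.
have := mean_touches 0 L p' q'; have := mean_touches_line 0 L J q'.
rewrite max0n -/U; lra.
Qed.

Definition cut_at L J w j := straight_cut L J (take j w) (drop j w).

(** Only the [l] steps before and the [l] steps after time [i + l] are seen. *)
Definition local_cut L J l w i :=
  straight_cut L J (take l (drop i w)) (take l (drop (i + l) w)).

(** What spoils a local cut time is a contact between times which are more than
[l] apart. *)
Lemma local_cut_le L J l s t : (L <= l <= size s)%N -> (l <= size t)%N ->
  (straight_cut L J (lastn l s) (take l t) && ~~ straight_cut L J s t)%:R <=
  touches l s t + touches_line l J t.
Proof.
move=> ls lt.
have sum1 p q (B : nat -> nat -> bool) a b : (0 < a <= p)%N -> (0 < b <= q)%N ->
    (l < a + b)%N -> B a b -> 1 <= \sum_(1 <= a < p.+1) \sum_(1 <= b < q.+1)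
      (l < a + b)%N%:R * (B a b)%:R :> R.
  move=> ap bq lab ab.
  rewrite (bigD1_seq a) ?iota_uniq ?mem_index_iota //=.
  rewrite (bigD1_seq b) ?iota_uniq ?mem_index_iota //=.
  rewrite lab ab mulr1 -addrA lerDl.
  apply: addr_ge0; apply: sumr_ge0 => i _; first by rewrite mulr_ge0.
  by apply: sumr_ge0 => j _; rewrite mulr_ge0.
have touches0 : 0 <= touches l s t.
  by apply: sumr_ge0 => a _; apply: sumr_ge0 => b _; rewrite mulr_ge0.
have touches_line0 : 0 <= touches_line l J t.
  by apply: sumr_ge0 => a _; apply: sumr_ge0 => b _; rewrite mulr_ge0.
case: andP => [[]|_] /=; last by rewrite addr_ge0.
rewrite /straight_cut lastn_lastn ?take_takel; try lia.
rewrite size_lastn size_takel // (minn_idPl _); last lia.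
move=> /and4P[-> -> no_touch no_line] /=.
rewrite negb_and !negbK => /orP[].
  move=> /hasP[a]; rewrite mem_iota => ap /hasP[b]; rewrite mem_iota => bp ab.
  rewrite ler_wpDr // (sum1 _ _ (touch s t) a b) //; try lia.
  rewrite ltnNge; apply: contra no_touch => abl.
  apply/hasP; exists a; first by rewrite mem_iota; lia.
  apply/hasP; exists b; first by rewrite mem_iota; lia.
  by rewrite /touch lastn_lastn ?take_takel //; lia.
move=> /hasP[a]; rewrite mem_iota => ap /hasP[b]; rewrite mem_iota => bp ab.
rewrite ler_wpDl // (sum1 _ _ (touch_line t) a b) //; try lia.
rewrite ltnNge; apply: contra no_line => abl.
apply/hasP; exists a; first by rewrite mem_iota; lia.
apply/hasP; exists b; first by rewrite mem_iota; lia.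
by rewrite /touch_line take_takel //; lia.
Qed.

Lemma mean_local_not_cut L J l N i : (L <= l)%N -> (i + 2 * l <= N)%N ->
  mean N (fun w => (local_cut L J l w i && ~~ cut_at L J w (i + l))%:R) <=
  2 * tail l.
Proof.
have cardD := card_dir_gt0 d_gt0.
move=> Ll iN; have jN : (i + l <= N)%N by lia.
set j := (i + l)%N in jN *; set r := (N - j)%N.
apply: (@le_trans _ _ (mean N (fun w =>
    touches l (take j w) (drop j w) + touches_line l J (drop j w)))).
  apply: le_mean => w sw.
  have -> : local_cut L J l w i =
      straight_cut L J (lastn l (take j w)) (take l (drop j w)).
    by rewrite /local_cut lastn_take ?addnK //; rewrite /j sw; lia.
  have sjw : size (take j w) = j by rewrite size_takel ?sw.
  by apply: local_cut_le; rewrite ?sjw ?size_drop ?sw /j; lia.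
rewrite -(subnKC jN) mean_cat -/r.
have -> : 2 * tail l = tail (maxn l (2 * 0)) + tail (maxn l (2 * 0)).
  by rewrite muln0 maxn0 mulr2n mulrDl mul1r.
have := mean_touches l 0 j r; have := mean_touches_line l 0 J r.
rewrite -[X in X <= _ -> _](mean_cst cardD j) => le1 le2.
apply: le_trans (lerD le2 le1); rewrite -meanD; apply: le_mean => s ss.
rewrite -meanD; apply: le_mean => t st.
by rewrite take_size_cat // drop_size_cat //= cats0.
Qed.

Lemma local_cut_drop L J l w m i :
  local_cut L J l w (m + i) = local_cut L J l (drop m w) i.
Proof. by rewrite /local_cut !drop_drop addnC addnAC [(i + m)%N]addnC. Qed.

(** Disjoint windows are independent. *)
Lemma mean_no_local_cut L J l K r : (L <= l)%N -> tail (2 * L) <= 4^-1 ->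
  mean (2 * l * K + r) (fun w =>
    (all (fun k => ~~ local_cut L J l w (2 * l * k)) (iota 0 K))%:R)
  <= (1 - density L) ^+ K.
Proof.
have cardD := card_dir_gt0 d_gt0.
move=> Ll tail_le.
pose P K w := all (fun k => ~~ local_cut L J l w (2 * l * k)) (iota 0 K).
have PS K' x1 x2 y : size x1 = l -> size x2 = l ->
    P K'.+1 (x1 ++ x2 ++ y) = ~~ straight_cut L J x1 x2 && P K' y.
  move=> s1 s2; rewrite /P /= muln0 {1}/local_cut drop0 add0n.
  rewrite take_size_cat // drop_size_cat // take_size_cat //; congr andb.
  rewrite -[1%N]/(1 + 0)%N iotaDl all_map; apply: eq_all => k /=.
  rewrite mulnDr muln1 local_cut_drop catA drop_size_cat //.
  by rewrite size_cat s1 s2 mul2n addnn.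
have dens : density L <= mean l (fun s => mean l (fun t => (straight_cut L J s t)%:R)).
  exact: straight_cut_ge.
have dens01 : 0 <= 1 - density L.
  rewrite subr_ge0; apply: le_trans dens _.
  rewrite -[leRHS](mean_cst cardD l); apply: le_mean => s _.
  rewrite -[leRHS](mean_cst cardD l); apply: le_mean => t _.
  by rewrite lern1 leq_b1.
rewrite (eq_mean (g := fun w => (P K w)%:R)) //; elim: K => [|K IHK].
  by rewrite expr0 -[leRHS](mean_cst cardD (2 * l * 0 + r)); apply: le_mean.
rewrite (_ : 2 * l * K.+1 + r = l + (l + (2 * l * K + r)))%N; last lia.
rewrite mean_cat (eq_mean (g := fun s => mean l (fun t =>
   (1 - (straight_cut L J s t)%:R) *
   mean (2 * l * K + r) (fun y => (P K y)%:R)))); last first.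
  move=> s ss; rewrite mean_cat; apply: eq_mean => t st.
  rewrite -meanZ; apply: eq_mean => y _; rewrite PS //.
  by case: straight_cut; rewrite ?subrr ?mul0r // subr0 mul1r.
set m := mean (_ + r) _ in IHK *.
rewrite (eq_mean (g := fun s => m * mean l (fun t =>
   1 - (straight_cut L J s t)%:R))); last first.
  by move=> s _; rewrite -meanZ; apply: eq_mean => t _; rewrite mulrC.
rewrite meanZ exprSr; apply: ler_pM => //.
- by apply: mean_ge0 => // w _; rewrite ler0n.
- apply: mean_ge0 => // s _; apply: mean_ge0 => // t _.
  by rewrite subr_ge0 lern1 leq_b1.
rewrite -[1 in leRHS](mean_cst cardD l).
apply: le_trans (lerB (lexx _) dens); rewrite -meanB; apply: le_mean => s _.
by rewrite meanB mean_cst.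
Qed.

(** If there is no cut time, then either no window has a local one in its middle,
or a contact between remote times spoils the local cut time of some window. *)
Lemma mean_no_cut L J l K N s : (0 < l)%N -> (L <= l)%N -> tail (2 * L) <= 4^-1 ->
  (s + 2 * l * K <= N)%N ->
  mean N (fun w => (~~ has (cut_at L J w) (iota s (2 * l * K)))%:R) <=
  (1 - density L) ^+ K + K%:R * (2 * tail l).
Proof.
have cardD := card_dir_gt0 d_gt0.
move=> l0 Ll tail_le sN.
pose P w := all (fun k => ~~ local_cut L J l w (2 * l * k)) (iota 0 K).
pose Q k w := local_cut L J l w (s + 2 * l * k) &&
  ~~ cut_at L J w (s + 2 * l * k + l).
apply: (@le_trans _ _ (mean N (fun w => (P (drop s w))%:R +
    \sum_(k <- iota 0 K) (Q k w)%:R))).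
  apply: le_mean => w sw; case: hasP => no_cut /=; first by rewrite addr_ge0 ?sumr_ge0.
  have [|notP] := boolP (P (drop s w)); first by rewrite lerDl sumr_ge0.
  rewrite add0r; apply: le_trans (has_le_sum _ _ _).
  rewrite ler1n lt0b; move: notP; rewrite -has_predC => /hasP[k kK /=].
  rewrite negbK -local_cut_drop => locP; apply/hasP; exists k => //.
  rewrite /Q locP /=; apply/negP => cutP; apply: no_cut.
  exists (s + 2 * l * k + l)%N => //; rewrite mem_iota.
  move: kK; rewrite mem_iota add0n => kK; nia.
rewrite meanD; apply: lerD.
  rewrite (mean_drop cardD (fun w => (P w)%:R)); last by lia.
  rewrite -(subnKC (_ : 2 * l * K <= N - s)%N); last lia.
  exact: mean_no_local_cut.
rewrite mean_sum // big_seq.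
apply: (@le_trans _ _ (\sum_(k <- iota 0 K) 2 * tail l)).
  rewrite [leRHS]big_seq; apply: ler_sum => k; rewrite mem_iota add0n => kK.
  apply: mean_local_not_cut => //; nia.
by rewrite big_const_seq count_predT size_iota iter_addr_0 [K%:R * _]mulr_natl.
Qed.

End StraightCut.

(** * Times from which cut times always outnumber gaps *)

Definition leader (c : nat -> int) N j : bool :=
  all (fun m => 0 < \sum_(j <= s < m) c s) (iota j.+1 (N - j)).

(** Walk along the partial sums: since they increase by at most one at a time,
each new height is left for the last time at a different index, and such an
index is a leader. *)
Lemma sum_le_leaders (c : nat -> int) N : (forall s, c s <= 1) ->
  \sum_(0 <= s < N) c s <= (count (leader c N) (iota 0 N))%:Z.
Proof.
move=> c1; suff: forall m, (m <= N)%N ->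
  \sum_(m <= s < N) c s <= (count (leader c N) (iota 0 N))%:Z by apply.
elim: N c c1 => [|N IHN] c c1 m mN.
  by rewrite (_ : m = 0)%N ?big_geq //; lia.
pose c' s := c s.+1.
have sumS a b : \sum_(a.+1 <= s < b.+1) c s = \sum_(a <= s < b) c' s.
  by rewrite big_add1.
have leaderS j : leader c N.+1 j.+1 = leader c' N j.
  rewrite /leader subSS -[j.+2]/(1 + j.+1)%N iotaDl all_map.
  by apply: eq_all => k /=; rewrite add1n sumS.
have -> : count (leader c N.+1) (iota 0 N.+1) =
    (leader c N.+1 0 + count (leader c' N) (iota 0 N))%N.
  rewrite /= -[1%N]/(1 + 0)%N iotaDl count_map; congr addn.
  by apply: eq_count => j /=; rewrite add1n leaderS.
have {}IHN k : (k <= N)%N -> \sum_(k <= s < N) c' s <=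
    (count (leader c' N) (iota 0 N))%:Z by apply: IHN => s; apply: c1.
case: m mN => [_|m mN]; last first.
  by rewrite sumS (le_trans (IHN m mN)) // lez_nat leq_addl.
have [_|/allPn[m]] := boolP (leader c N.+1 0).
  rewrite big_ltn // sumS PoszD lerD //; exact: IHN.
rewrite mem_iota => m_le; rewrite -leNgt => sum_le0 /=.
rewrite (big_cat_nat (n := m)) //=; last lia.
case: m m_le sum_le0 => [|m] m_le sum_le0; first lia.
have mN : (m <= N)%N by lia.
by rewrite [X in _ + X]sumS -[leRHS]add0r lerD ?IHN.
Qed.

Lemma sumz_count (p : pred nat) (r : seq nat) :
  \sum_(x <- r) (p x)%:Z = (count p r)%:Z.
Proof. by elim: r => [|x r IHr]; rewrite ?big_nil // big_cons IHr -PoszD. Qed.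

Lemma leq_count_in (T : eqType) (a1 a2 : pred T) (r : seq T) :
  {in r, forall x, a1 x -> a2 x} -> (count a1 r <= count a2 r)%N.
Proof.
move=> sub; rewrite -!size_filter
  (_ : [seq x <- r | a1 x] = [seq x <- [seq x <- r | a2 x] | a1 x]).
  by rewrite size_filter count_size.
rewrite -filter_predI; apply: eq_in_filter => x /sub /=.
by case: (a1 x) => // ->.
Qed.

Section Good.
Variable d : nat.
Variable e : dir d.

Definition time_cut (w : seq (dir d)) (t : nat) : bool :=
  all (fun i => all (fun k => (1 < norm1 (pos (take k w) - pos (take i w)))%N)
    (iota t.+1 (size w - t))) (iota 0 t).

(** The last time counts as a cut time, since nothing comes after it. If the walk
returned to its start at that time, this would be one too many for
[count_cut_gdist]; a cut at time one excludes such a return. *)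
Definition good (w : seq (dir d)) : bool :=
  time_cut w 1 &&
  all (fun s => has (fun t => ((t == size w) || time_cut w t) &&
      (t < s + count (time_cut w) (iota 1 t))%N) (iota s (size w - s).+1))
    (iota 1 (size w)).

Lemma pos_take_drop (w : seq (dir d)) t b :
  pos (take b (drop t w)) = pos (take (t + b) w) - pos (take t w).
Proof.
by rewrite takeD pos_cat addrAC subrr add0r.
Qed.

Lemma touch_pos (w : seq (dir d)) t a b : (a <= t <= size w)%N ->
  touch (take t w) (drop t w) a b =
  (norm1 (pos (take (t + b) w) - pos (take (t - a) w)) <= 1)%N.
Proof.
move=> atw; rewrite /touch lastn_take // !pos_take_drop subnK; last lia.
by congr (norm1 _ <= 1)%N; rewrite addrC addrA subrK.
Qed.

Variables (L M : nat).
Let J := M.+1.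

Definition cut_excess (w : seq (dir d)) s : int :=
  (cut_at e L J w s)%:Z - (~~ has (cut_at e L J w) (iota s M))%:Z.

Lemma cut_excess_le1 w s : cut_excess w s <= 1.
Proof. by rewrite /cut_excess; case: cut_at; case: has. Qed.

(** Let [t0] be the first cut time after a time [s0], or the end of the walk. Of
the [t0 - s0] times without cuts all but the last [M] have negative weight, so a
leader before [s0] has at least [t0 - s0 - M] cut times between itself and
[t0]. The straight steps in front consist of cut times only and make up for
[M]. *)
Lemma leader_good w N n j : (N <= size w)%N -> (j + n <= N)%N -> (j < N)%N ->
  leader (cut_excess w) N j -> good (nseq J e ++ take n (drop j w)).
Proof.
move=> Nw jnN jN /allP lead.
have {}lead m : (j < m <= N)%N -> 0 < \sum_(j <= s < m) cut_excess w s.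
  by move=> jm; apply: lead; rewrite mem_iota; lia.
have cutj : cut_at e L J w j.
  have := lead j.+1; rewrite big_nat1 /cut_excess => /(_ ltac:(lia)).
  by case: cut_at => //; case: has.
have line i b : (0 < i <= J)%N -> (0 < b <= n)%N ->
    (1 < norm1 (step e *+ i + pos (take b (drop j w))))%N.
  move=> iJ bn; have /and4P[_ _ _ /hasPn /(_ i)] := cutj.
  rewrite mem_iota size_drop => /(_ ltac:(lia)) /hasPn /(_ b).
  by rewrite mem_iota => /(_ ltac:(lia)); rewrite -ltnNge.
set Y := take n (drop j w); set Z := nseq J e ++ Y.
have sizeZ : size Z = (J + n)%N.
  by rewrite size_cat size_nseq size_takel // size_drop; lia.
have posZ k : (k <= J + n)%N -> pos (take k Z) =
    step e *+ minn k J + pos (take (k - J) (drop j w)).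
  by move=> kJ; rewrite take_nseq_cat pos_cat pos_nseq take_takel //; lia.
have far i k : (i < J)%N -> (i.+1 < k <= J + n)%N ->
    (1 < norm1 (pos (take k Z) - pos (take i Z)))%N.
  move=> iJ ik; rewrite !posZ; try lia.
  rewrite (_ : i - J = 0)%N ?take0 ?pos_nil ?addr0; last lia.
  rewrite addrAC -mulrnBr; last lia.
  have [kJ|Jk] := leqP k J.
    rewrite (_ : k - J = 0)%N ?take0 ?pos_nil ?addr0 ?norm1_stepMn; last lia.
    by lia.
  by apply: line; lia.
have cut_prefix t : (0 < t <= J)%N -> time_cut Z t.
  move=> tJ; apply/allP => i; rewrite mem_iota => it.
  by apply/allP => k; rewrite mem_iota sizeZ => kt; apply: far; lia.
have cut_suffix t : (t <= n)%N -> cut_at e L J w (j + t) -> time_cut Z (J + t).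
  move=> tn cut_t; apply/allP => i; rewrite mem_iota => it.
  apply/allP => k; rewrite mem_iota sizeZ => kt.
  have [iJ|Ji] := ltnP i J; first by apply: far; lia.
  rewrite !posZ; try lia.
  rewrite (_ : minn k J = minn i J); last lia.
  rewrite addrAC opprD addrA subrr add0r addrC.
  rewrite !pos_take_drop opprB addrA subrK.
  have /and4P[_ _ /hasPn /(_ (t + J - i)%N) + _] := cut_t.
  rewrite mem_iota size_takel ?size_drop; last lia.
  move=> /(_ ltac:(lia)) /hasPn /(_ (k - J - t)%N).
  rewrite mem_iota => /(_ ltac:(lia)).
  rewrite touch_pos; last lia.
  rewrite -ltnNge (_ : j + t + (k - J - t) = j + (k - J))%N; last lia.
  by rewrite (_ : j + t - (t + J - i) = j + (i - J))%N; last lia.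
apply/andP; split; first by apply: cut_prefix.
apply/allP => s; rewrite mem_iota sizeZ => sZ.
have [sJ|Js] := leqP s J.
  apply/hasP; exists s; first by rewrite mem_iota; lia.
  rewrite cut_prefix ?orbT /=; last lia.
  rewrite -[X in (X < _)%N]addn0 ltn_add2l -has_count; apply/hasP; exists s.
    by rewrite mem_iota; lia.
  by apply: cut_prefix; lia.
set s0 := (j + (s - J))%N.
set r := iota s0 (j + n - s0); set f := find (cut_at e L J w) r.
have f_le : (f <= j + n - s0)%N by rewrite -[leqRHS](size_iota s0) find_size.
have no_cut x : (s0 <= x < s0 + f)%N -> cut_at e L J w x = false.
  move=> xs; have := @before_find _ 0%N (cut_at e L J w) r (x - s0)%N.
  by rewrite nth_iota ?subnKC; try lia; apply; rewrite -/f; lia.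
set t0 := (s0 + f)%N.
have t0_cut : t0 = (j + n)%N \/ cut_at e L J w t0.
  have [hasr|] := boolP (has (cut_at e L J w) r).
    right; have := nth_find 0%N hasr; rewrite nth_iota //.
    by have := hasr; rewrite has_find size_iota.
  move/hasNfind; rewrite -/f size_iota => fE; left; rewrite /t0 fE /s0; lia.
have t0_le : (s0 <= t0 <= j + n)%N by rewrite /t0; lia.
pose k := (t0 - j)%N.
apply/hasP; exists (J + k)%N; first by rewrite mem_iota /k /s0 in t0_le *; lia.
apply/andP; split.
  case: t0_cut => [t0E|cut_t0].
    by apply/orP; left; apply/eqP; rewrite /k; lia.
  by apply/orP; right; apply: cut_suffix; rewrite /k ?subnKC //; lia.
pose U x := ~~ has (cut_at e L J w) (iota x M).
have countU : (f - M <= count U (iota j k))%N.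
  rewrite (_ : k = s0 - j + ((f - M) + minn f M))%N; last by rewrite /k /t0 /s0; lia.
  rewrite iotaD subnKC; last by rewrite /s0; lia.
  rewrite iotaD !count_cat (@eq_in_count _ U predT (iota s0 (f - M))).
    by rewrite count_predT size_iota; lia.
  move=> x; rewrite mem_iota => xs; rewrite /U /=; apply/hasPn => y.
  by rewrite mem_iota => yx; rewrite no_cut //; lia.
have := lead t0; rewrite /cut_excess sumrB !sumz_count /index_iota -/k => lead_t0.
have {}lead_t0 : (count U (iota j k) < count (cut_at e L J w) (iota j k))%N.
  by have := lead_t0 ltac:(rewrite /s0 in t0_le; lia); rewrite subr_gt0 ltz_nat.
have countE : (count (cut_at e L J w) (iota j k) <=
    1 + count (fun x => cut_at e L J w (j + x)) (iota 1 k))%N.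
  rewrite -(count_map (addn j)) -iotaDl addn1.
  have -> : k = k.-1.+1 by rewrite /k /s0 in t0_le *; lia.
  by rewrite -[X in iota j.+1 X]addn1 iotaD count_cat /=; case: cut_at; lia.
have countZ : (count (fun x => cut_at e L J w (j + x)) (iota 1 k) <=
    count (time_cut Z) (iota (1 + J) k))%N.
  rewrite addnC iotaDl count_map; apply: leq_count_in => x.
  by rewrite mem_iota => xk; apply: cut_suffix; rewrite /k in xk; lia.
have countJ : count (time_cut Z) (iota 1 J) = J.
  rewrite -[RHS](size_iota 1) -[RHS]count_predT; apply: eq_in_count => x.
  by rewrite mem_iota => xJ; rewrite cut_prefix //; lia.
rewrite iotaD count_cat countJ.
move: countU lead_t0 countE countZ t0_le; rewrite /k /t0 /s0.
move: (count _ _) (count _ _) (count _ _) (count _ _) => *; lia.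
Qed.

End Good.

Section GoodProbability.
Variables (R : realType) (d : nat).
Hypothesis d_ge5 : (5 <= d)%N.
Let d_gt0 : (0 < d)%N. Proof. exact: leq_trans d_ge5. Qed.
Variable e : dir d.

Let tail l : R := pair_cst R d * (2 / Num.sqrt l.+1%:R).

Let tail_small x : 0 < x -> exists l0, forall l, (l0 <= l)%N -> tail l <= x.
Proof.
move=> x0; have C0 := pair_cst_gt0 R d_ge5.
exists (Num.bound ((pair_cst R d * 2 / x) ^+ 2)) => l l0l.
have lt_l : (pair_cst R d * 2 / x) ^+ 2 < l.+1%:R.
  apply: lt_le_trans (archi_boundP (sqr_ge0 _)) _.
  by rewrite ler_nat leqW.
have s0 : 0 < Num.sqrt l.+1%:R :> R by rewrite sqrtr_gt0.
rewrite /tail mulrA ler_pdivrMr // [x * _]mulrC -ler_pdivrMr //.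
have Cx0 : 0 <= pair_cst R d * 2 / x by rewrite ltW ?divr_gt0 // mulr_gt0.
rewrite -(@ler_pXn2r _ 2) ?nnegrE ?(ltW s0) //.
by rewrite sqr_sqrtr ?ler0n ?(ltW lt_l).
Qed.

Let pow_small (y x : R) : 0 < y -> y < 1 -> 0 < x ->
  exists2 K, (0 < K)%N & (1 - y) ^+ K <= x.
Proof.
move=> y0 y1 x0; pose K := (Num.bound (x^-1 / y)).+1; exists K => //.
have bern k : (1 - y) ^+ k * (1 + k%:R * y) <= 1.
  elim: k => [|k IHk]; first by rewrite expr0 mul0r addr0 mulr1.
  apply: le_trans IHk; rewrite exprS -mulrA mulrCA ler_wpM2l ?exprn_ge0 ?subr_ge0 ?ltW //.
  by rewrite -natr1; have := ler0n R k; nra.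
have xK : x^-1 <= 1 + K%:R * y.
  rewrite ler_wpDl // -ler_pdivrMr //.
  apply: le_trans (ltW (archi_boundP _)) _; first by rewrite divr_ge0 ?invr_ge0 ?ltW.
  by rewrite ler_nat.
have D0 : 0 < 1 + K%:R * y by rewrite ltr_wpDr ?mulr_ge0 ?ltW.
apply: le_trans (_ : (1 + K%:R * y)^-1 <= _).
  by rewrite -[leRHS]mul1r ler_pdivlMr.
by rewrite -[leRHS]invrK lef_pV2 ?posrE ?invr_gt0.
Qed.

(** Every leader among the first [N' - n] times of a long walk is followed by [n]
steps as in the statement, and these steps are uniform.

The constants are chosen in the order: half-length [L] of the straight
windows, number [K] of independent windows, their half-length [l], and last the
length of the straight path in front; the bounds for the first three do not
depend on the latter. *)
Lemma good_after_straight : exists J, exists2 delta : R, 0 < delta &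
  forall n, delta <= mean n (fun w => (good (nseq J e ++ w))%:R).
Proof.
have cardD := card_dir_gt0 d_gt0.
have q0 : 0 < 4^-1 :> R by rewrite invr_gt0.
have [L0 /(_ (2 * L0)%N) tailL] := tail_small q0.
set L := L0; have {}tailL : tail (2 * L) <= 4^-1 by apply: tailL; lia.
set rho := density R d L.
have rho0 : 0 < rho.
  by rewrite /rho /density divr_gt0 // exprn_gt0 // invr_gt0 ltr0n muln_gt0.
have rho1 : rho < 1.
  have : (2 * d)%:R^-1 ^+ (2 * L) <= 1 :> R.
    by rewrite exprn_ile1 ?invr_ge0 // invf_le1 ?ltr0n ?ler1n muln_gt0.
  by rewrite /rho /density; lra.
have r4 : 0 < rho / 4 by rewrite divr_gt0.
have [K K0 powK] := pow_small rho0 rho1 r4.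
have r4K : 0 < rho / 8 / K%:R by rewrite divr_gt0 ?ltr0n // divr_gt0.
have [l0 tail_l0] := tail_small r4K.
pose l := (maxn 1 (maxn L l0)).
have tail_l : K%:R * (2 * tail l) <= rho / 4.
  have := tail_l0 l ltac:(rewrite /l; lia); rewrite ler_pdivlMr ?ltr0n //.
  by rewrite mulrC; lra.
pose M := (2 * l * K)%N; pose J := M.+1.
exists J, (rho / 4) => // n.
set pi := mean n _.
(* The boundary term [L + n] disappears as [N'] grows. *)
suff main N' : (N'%:R * (rho / 2) <= N'%:R * pi + (L + n)%:R).
  rewrite leNgt; apply/negP => pi_lt.
  have gap0 : 0 < rho / 2 - pi by lra.
  have := archi_boundP (divr_ge0 (ler0n R (L + n)) (ltW gap0)).
  rewrite ltr_pdivrMr // mulrBr => lt_bound.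
  by have := main (Num.bound ((L + n)%:R / (rho / 2 - pi))); lra.
pose N := (N' + M)%N.
have leaders_ge : N'%:R * (rho / 2) - L%:R <=
    \sum_(j <- iota 0 N') mean N (fun w => (leader (cut_excess e L M w) N' j)%:R).
  rewrite -mean_sum //.
  apply: (@le_trans _ _ (mean N (fun w =>
      \sum_(j <- iota 0 N') (cut_excess e L M w j)%:~R))).
    rewrite mean_sum //.
    apply: (@le_trans _ _ (\sum_(j <- iota 0 N') ((L <= j)%N%:R * rho - rho / 2))).
      have -> : \sum_(j <- iota 0 N') ((L <= j)%N%:R * rho - rho / 2) =
          N'%:R * (rho / 2) - (minn N' L)%:R * rho.
        rewrite -[N' in iota 0 N']subn0 -/(index_iota 0 N').
        elim: (N') => [|m IHm]; first by rewrite big_geq // min0n !mul0r subrr.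
        rewrite big_nat_recr //= IHm -[m.+1%:R]natr1.
        case: (boolP (L <= m)%N) => Lm.
          by rewrite (_ : minn m.+1 L = minn m L) /= ?mulr1n; [lra|lia].
        rewrite (_ : minn m.+1 L = (minn m L).+1); last lia.
        by rewrite -[(minn m L).+1%:R]natr1 /= mulr0n; lra.
      rewrite lerD2l lerN2; apply: (@le_trans _ _ (minn N' L)%:R).
        by rewrite ler_piMr // ltW.
      by rewrite ler_nat geq_minr.
    rewrite big_seq [leRHS]big_seq; apply: ler_sum => j; rewrite mem_iota => jN.
    rewrite (eq_mean (g := fun w => (cut_at e L J w j)%:R -
        (~~ has (cut_at e L J w) (iota j M))%:R)); last first.
      by move=> w _; rewrite /cut_excess rmorphB.
    rewrite meanB lerB //; last first.
      apply: le_trans (mean_no_cut d_ge5 _ _ _ _ _ _) _ => //;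
        try (rewrite /l /N /M; lia).
      by apply: le_trans (lerD powK tail_l) _; lra.
    have [Lj|jL] := leqP L j; last by rewrite mul0r mean_ge0.
    rewrite mul1r /N -(subnKC (_ : j <= N' + M)%N); last lia.
    rewrite mean_cat.
    have LM : (L <= M)%N by rewrite /M /l; nia.
    apply: le_trans (straight_cut_ge d_ge5 e J Lj _ tailL) _; last first.
      apply: le_mean => s ss; apply: le_mean => t st.
      by rewrite /cut_at take_size_cat // drop_size_cat.
    lia.
  apply: le_mean => w sw.
  have := sum_le_leaders N' (cut_excess_le1 e L M w).
  rewrite -sumz_count -(ler_int R) !rmorph_sum /index_iota subn0 /= => le_count.
  by apply: le_trans le_count _; rewrite le_eqVlt; apply/orP; left; apply/eqP/eq_bigr.
have leaders_le : \sum_(j <- iota 0 N') mean N (fun w =>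
    (leader (cut_excess e L M w) N' j)%:R) <= N'%:R * pi + n%:R.
  apply: (@le_trans _ _ (\sum_(j <- iota 0 N') (pi + (N' < j + n)%N%:R))).
    rewrite big_seq [leRHS]big_seq; apply: ler_sum => j; rewrite mem_iota => jN.
    have [jnN|Njn] := leqP (j + n) N'; last first.
      rewrite ler_wpDl ?mean_ge0 // -[leRHS](mean_cst cardD N).
      by apply: le_mean => w _; rewrite lern1 leq_b1.
    rewrite addr0.
    have -> : pi = mean N (fun w => (good (nseq J e ++ take n (drop j w)))%:R).
      rewrite (mean_drop cardD (fun w => (good (nseq J e ++ take n w))%:R)); last first.
        by rewrite /N; lia.
      rewrite (mean_take cardD (fun w => (good (nseq J e ++ w))%:R)) //.
      by rewrite /N; lia.
    apply: le_mean => w sw; rewrite ler_nat.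
    case: (boolP (leader _ _ _)) => // lead_j.
    by rewrite (leader_good _ jnN _ lead_j) // ?sw /N; lia.
  rewrite big_split /= big_const_seq count_predT size_iota iter_addr_0.
  rewrite mulr_natl lerD2l -natr_sum ler_nat.
  rewrite -[N' in iota 0 N']subn0 -/(index_iota 0 N').
  apply: (@leq_trans (\sum_(0 <= j < N') (N' - n <= j))%N).
    by apply: leq_sum => j _; lia.
  have -> t m : (\sum_(0 <= j < m) (t <= j) = m - t)%N; last lia.
  elim: m => [|m IHm]; first by rewrite big_geq.
  by rewrite big_nat_recr //= IHm; lia.
by rewrite natrD; lra.
Qed.

Lemma good_probability : exists J, exists2 delta : R, 0 < delta &
  forall n, (J <= n)%N -> delta <= mean n (fun w : seq (dir d) => (good w)%:R).
Proof.
have [J [delta delta0 delta_le]] := good_after_straight.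
exists J, ((2 * d)%:R^-1 ^+ J * delta).
  by rewrite mulr_gt0 // exprn_gt0 // invr_gt0 ltr0n muln_gt0.
move=> n /subnKC <-.
have := mean_prefix (f := fun w : seq (dir d) => (good w)%:R : R) (card_dir_gt0 d_gt0)
  (nseq J e) (n - J) (fun w => ler0n _ _).
rewrite size_nseq card_dir; apply: le_trans.
by rewrite ler_wpM2l ?exprn_ge0 ?invr_ge0.
Qed.

End GoodProbability.

(** * Cut times and diametrical paths *)

Section GraphDistance.
Variables (T : finType) (e : rel T).
Implicit Types (x y z : T) (p : seq T).

(** Walks of length [#|T|] or more are covered by the default value of
[gdist]. *)
Lemma gdist_le x p : path e x p -> (gdist e x (last x p) <= size p)%N.
Proof.
move=> xp; rewrite /gdist; set a := fun k => _.
have a_p : a (size p).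
  by apply/existsP; exists (in_tuple p); rewrite xp eqxx.
have [pT|Tp] := ltnP (size p) #|T|; last first.
  by apply: leq_trans Tp; rewrite -[leqRHS](size_iota 0) find_size.
rewrite leqNgt; apply/negP => /(before_find 0%N).
by rewrite nth_iota // add0n a_p.
Qed.

Lemma gdist_path x p : path e x p ->
  exists q, [/\ path e x q, last x q = last x p, uniq (x :: q) &
             size q = gdist e x (last x p)].
Proof.
move=> xp; pose k := gdist e x (last x p).
have kT : (k < #|T|)%N.
  case/shortenP: xp @k => q xq uq _ k; apply: leq_ltn_trans (gdist_le xq) _.
  by rewrite -[X in (X < _)%N]/(size (x :: q)).-1 prednK // -(card_uniqP uq) max_card.
have hask : has (fun k => [exists q : k.-tuple T, path e x q && (last x q == last x p)])
    (iota 0 #|T|).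
  by rewrite has_find size_iota.
have := nth_find 0%N hask; rewrite -/(gdist e x (last x p)) nth_iota // add0n.
move=> /existsP[q /andP[xq /eqP lq]]; have sq := size_tuple q.
move: lq sq; case/shortenP: xq => r xr xur sr lr sq.
have /andP[_ ur] := xur; exists r; rewrite lr; split=> //; apply/eqP; rewrite eqn_leq.
have := gdist_le xr; rewrite lr => ->; rewrite andbT.
by rewrite -[leqRHS]sq; apply: uniq_leq_size => // y; apply: sr.
Qed.

Lemma gdist_refl x : gdist e x x = 0%N.
Proof. by apply/eqP; rewrite -leqn0; exact: (@gdist_le x [::]). Qed.

Lemma leq_gdiam x y : (gdist e x y <= gdiam e)%N.
Proof.
apply: leq_trans (bigop.leq_bigmax (F := fun x => \max_(y : T) gdist e x y) x).
exact: (bigop.leq_bigmax (F := fun y => gdist e x y)).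
Qed.

Hypothesis e_connected : forall x y, exists2 p, path e x p & last x p = y.

Lemma gdist_ex x y : exists p,
  [/\ path e x p, last x p = y, uniq (x :: p) & size p = gdist e x y].
Proof. by have [p xp <-] := e_connected x y; apply: gdist_path. Qed.

Lemma gdist_eq0 x y : gdist e x y = 0%N -> x = y.
Proof. by have [[|? ?] [_ <- _ <-]] := gdist_ex x y. Qed.

Lemma gdist_triangle x y z : (gdist e x z <= gdist e x y + gdist e y z)%N.
Proof.
have [p [xp py _ <-]] := gdist_ex x y; have [q [yq qz _ <-]] := gdist_ex y z.
rewrite -size_cat -qz -py -last_cat; apply: gdist_le.
by rewrite cat_path xp py.
Qed.

Lemma gdiam_ex x0 : exists x y, gdist e x y = gdiam e.
Proof.
have T0 : (0 < #|T|)%N by apply/card_gt0P; exists x0.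
have [x xE] := bigop.eq_bigmax (fun x => \max_(y : T) gdist e x y) T0.
have [y yE] := bigop.eq_bigmax (fun y => gdist e x y) T0.
by exists x, y; rewrite -yE -xE.
Qed.

Lemma diametrical_ex x0 : exists p : (gdiam e).+1.-tuple T, diametrical p.
Proof.
have [x [y xyE]] := gdiam_ex x0; have [p [xp py up sp]] := gdist_ex x y.
have sxp : size (x :: p) == (gdiam e).+1 by rewrite /= sp xyE.
exists (Tuple sxp); rewrite /diametrical /= xp -[~~ _ && _]/(uniq (x :: p)) up.
rewrite !(tnth_nth x) /= -[X in nth x _ X](_ : size p = _); last by rewrite sp.
by rewrite -last_nth py xyE.
Qed.

(** Each diametrical path then has an endpoint in [A], which a fair choice finds
half of the time; the vertex [x0] provides a diametrical path. *)
Lemma Psi_law_ge_half (R : realType) (A : pred T) (x0 : T) :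
    (forall x y, gdist e x y = gdiam e -> A x \/ A y) ->
  2^-1 <= Psi_law e R A.
Proof.
move=> diamA; rewrite /Psi_law; set D := [set q | _].
have [p0 p0D] := diametrical_ex x0.
have D0 : #|D|%:R != 0 :> R.
  by rewrite pnatr_eq0 -lt0n; apply/card_gt0P; exists p0; rewrite inE.
apply: (@le_trans _ _ (\sum_(p : (gdiam e).+1.-tuple T | diametrical p)
    #|D|%:R^-1 * 2^-1 : R)).
  rewrite sumr_const -[leRHS]mulr_natl mulrA.
  rewrite (eq_card (B := mem D)) ?divff ?mul1r // => p.
  by rewrite inE.
apply: ler_sum => p /and3P[_ _ /eqP /diamA endA].
rewrite ler_wpM2l ?invr_ge0 ?ler0n //.
by case: endA => ->; case: (A _) => /=; lra.
Qed.

End GraphDistance.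

Section CutTimes.
Variables (T : finType) (e : rel T) (g : nat -> T) (n : nat).
Hypotheses (e_sym : symmetric e) (e_irr : irreflexive e).
Hypothesis g_onto : forall x, exists2 i, (i <= n)%N & g i = x.
Hypothesis g_step : forall i, (i < n)%N -> e (g i) (g i.+1).

Lemma walk_path i k : (i <= k <= n)%N ->
  exists p, [/\ path e (g i) p, last (g i) p = g k & size p = (k - i)%N].
Proof.
elim: k => [|k IHk] ik.
  by rewrite (_ : i = 0)%N; [exists [::]|lia].
have [->|ik1] := eqVneq i k.+1; first by exists [::]; rewrite subnn.
have [|p [ip pk sp]] := IHk; first lia.
exists (rcons p (g k.+1)); rewrite rcons_path last_rcons size_rcons ip pk sp.
by split=> //; [apply: g_step|]; lia.
Qed.

Lemma walk_gdist i k : (i <= k <= n)%N -> (gdist e (g i) (g k) <= k - i)%N.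
Proof. by move=> /walk_path[p [ip <- <-]]; apply: gdist_le. Qed.

Lemma walk_connected x y : exists2 p, path e x p & last x p = y.
Proof.
have [[i iN <-] [k kN <-]] := (g_onto x, g_onto y).
have [ik|ki] := leqP i k.
  by have [|p [ip pk _]] := @walk_path i k; [lia|exists p].
have [|p [kp pi _]] := @walk_path k i; first lia.
exists (rev (belast (g k) p)); first by rewrite -pi rev_path (eq_path (e' := e)).
by case: p kp pi => //= z p _ _; rewrite rev_cons last_rcons.
Qed.

Lemma gdist_sym x y : gdist e x y = gdist e y x.
Proof.
suff sym_le u v : (gdist e u v <= gdist e v u)%N by apply/eqP; rewrite eqn_leq !sym_le.
have [p [vp <- _ <-]] := gdist_ex walk_connected v u.
have := @gdist_le T e (last v p) (rev (belast v p)).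
rewrite rev_path (eq_path (e' := e)) // vp size_rev size_belast => /(_ isT).
by case: p {vp} => [|z p] //=; rewrite rev_cons last_rcons.
Qed.

Definition cut t := forall i k, (i < t)%N -> (t < k <= n)%N ->
  g i != g k /\ ~~ e (g i) (g k).

(** The points before and after the cut time are disjoint and not adjacent, and
together with the cut point they are all the vertices. *)
Lemma cut_on_path t i k p : cut t -> (i < t < k)%N -> (k <= n)%N ->
  path e (g i) p -> last (g i) p = g k -> g t \in p.
Proof.
move=> cut_t; elim: p i => [|y p IHp] i itk kn /=.
  by move=> _ gik; have := cut_t i k ltac:(lia) ltac:(lia); rewrite gik eqxx => -[].
case/andP=> iy yp yk; have [j jn gj] := g_onto y; rewrite -gj in iy yp yk *.
have [jt|tj|->] := ltngtP j t; last by rewrite mem_head.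
  by rewrite inE (IHp j) ?orbT //; lia.
by have := cut_t i j ltac:(lia) ltac:(lia); rewrite iy => -[].
Qed.

Lemma cut_gdist t i k : cut t -> (i <= t <= k)%N -> (k <= n)%N ->
  (gdist e (g i) (g t) + gdist e (g t) (g k) <= gdist e (g i) (g k))%N.
Proof.
move=> cut_t itk kn.
have [->|it] := eqVneq i t; first by rewrite gdist_refl.
have [->|kt] := eqVneq k t; first by rewrite gdist_refl addn0.
have [p [ip pk _ <-]] := gdist_ex walk_connected (g i) (g k).
have tp := @cut_on_path t i k p cut_t ltac:(lia) kn ip pk.
case/splitPr: tp ip pk => {}p q; rewrite cat_path last_cat /= => /and3P[ip pt tq] qk.
rewrite size_cat /= -addSnnS leq_add //; last by rewrite -qk gdist_le.
have := @gdist_le T e (g i) (rcons p (g t)).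
by rewrite rcons_path ip pt last_rcons size_rcons; apply.
Qed.

Variable C : pred nat.
Hypothesis C_cut : forall t, (0 < t <= n)%N -> C t -> cut t.
Hypothesis C1 : C 1.
Hypothesis n_gt0 : (0 < n)%N.

(** Cut points are distinct and all of them lie on the way. The induction needs
the strict bound at later cut times, where the next cut point counts itself. *)
Lemma count_cut_gdist t : (t <= n)%N ->
  (count C (iota 1 t) <= gdist e (g 0) (g t))%N.
Proof.
suff both s : (s <= n)%N ->
    (forall t, (s <= t <= n)%N -> (count C (iota 1 s) <= gdist e (g 0) (g t))%N) /\
    (forall t, (s < t <= n)%N -> C t -> (count C (iota 1 s) < gdist e (g 0) (g t))%N).
  by move=> tn; apply: (both t tn).1; lia.
elim: s {t} => [_|s IHs sn].
  split=> // t tn Ct; rewrite /= lt0n; apply/eqP.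
  move/(gdist_eq0 walk_connected) => g0t; have [t1|t1] := eqVneq t 1%N.
    by have := g_step n_gt0; rewrite g0t t1 e_irr.
  have := C_cut (t := 1%N) n_gt0 C1 (i := 0%N) (k := t) isT ltac:(lia).
  by rewrite g0t eqxx => -[].
have [IHa IHb] := IHs (ltnW sn).
rewrite -addn1 iotaD count_cat /= addn0 add1n.
case: (boolP (C s.+1)) => [Cs|_]; rewrite ?addn0 ?addn1; last first.
  by split=> t st; [apply: IHa|apply: IHb]; lia.
have cut_s := C_cut _ Cs; have lt_s := IHb s.+1 _ Cs.
have far t : (s.+1 <= t <= n)%N -> 
    (gdist e (g 0) (g s.+1) + gdist e (g s.+1) (g t) <= gdist e (g 0) (g t))%N.
  by move=> st; apply: cut_gdist; [apply: cut_s; lia|lia|lia].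
split=> t st; first by have := far t ltac:(lia); have := lt_s ltac:(lia); lia.
move=> _; have := far t ltac:(lia); have := lt_s ltac:(lia).
have : gdist e (g s.+1) (g t) != 0%N.
  apply/eqP => /(gdist_eq0 walk_connected) gst.
  have := cut_s ltac:(lia) s t ltac:(lia) ltac:(lia).
  by rewrite -gst g_step // => -[].
lia.
Qed.

(** Let [s <= t] be the times of two points other than the start, and [u] the
time associated with [s]. If [u < t], both the start and the point at time [s]
reach the point at time [t] through the cut point at time [u], from which the
start is farther than the point at time [s]. If [t <= u], the start and the
point at time [u] are farther apart than the two points. *)
Lemma gdiam_start :
    (forall s, (0 < s <= n)%N -> exists t, [/\ (s <= t <= n)%N, t = n \/ C t &
      (t < s + count C (iota 1 t))%N]) ->
  forall x y, gdist e x y = gdiam e -> x = g 0 \/ y = g 0.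
Proof.
move=> dense x y.
have [[s sn <-] [t tn <-]] := (g_onto x, g_onto y).
wlog st : s t sn tn / (s <= t)%N => [wlg|].
  have [st|ts] := leqP s t; first exact: wlg.
  by rewrite gdist_sym => /(wlg t s tn sn (ltnW ts)) [->|->]; [right|left].
have [->|s0] := posnP s; first by left.
have [|u [su uC lt_u]] := dense s; first lia.
have := count_cut_gdist (t := u) ltac:(lia).
have [tu|ut] := leqP t u.
  have := walk_gdist (i := s) (k := t) ltac:(lia).
  by have := leq_gdiam e (g 0) (g u); lia.
have {uC} Cu : C u by case: uC => //; lia.
have := walk_gdist (i := s) (k := u) ltac:(lia).
have := gdist_triangle walk_connected (g s) (g u) (g t).
have := @cut_gdist u 0 t (@C_cut u ltac:(lia) Cu) ltac:(lia) tn.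
have := leq_gdiam e (g 0) (g t); lia.
Qed.

End CutTimes.

(** * The walk as a random word *)

Lemma in_fset_seq (K : choiceType) (s : seq K) x :
  (x \in [fset y in s]%fset) = (x \in s).
Proof. by rewrite inE. Qed.

Section WalkGraph.
Variable d : nat.

Lemma lattice_adjE (x y : 'rV[int]_d) : lattice_adj x y = (norm1 (x - y) == 1)%N.
Proof.
rewrite /lattice_adj /norm1 (eq_bigr (fun j => (absz ((x - y)%R 0%R j))%:Z)).
  by rewrite -(big_morph Posz PoszD (erefl _)).
by move=> j _; rewrite !mxE abszE.
Qed.

Variables (v : 'rV[int]_d) (w : seq (dir d)).
Let n := size w.

Definition walk_at i := v + pos (take i w).
Definition walk_range : {fset 'rV[int]_d} :=
  [fset x in [seq walk_at i | i <- iota 0 n.+1]]%fset.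

Let walk_in i : walk_at (minn i n) \in walk_range.
Proof. by rewrite in_fset_seq; apply: map_f; rewrite mem_iota; lia. Qed.

Let g i : walk_range := [` walk_in i]%fset.

Let e := @induced_adj d walk_range.

Lemma good_Psi (R : realType) : (0 < n)%N -> good w ->
  2^-1 <= Psi_law e R (fun x => val x == v).
Proof.
move=> n0 /andP[cut1 /allP good_w].
have val_g i : (i <= n)%N -> val (g i) = walk_at i.
  by move=> i_n; rewrite /= (minn_idPl i_n).
have e_gg i k : (i <= n)%N -> (k <= n)%N ->
    e (g i) (g k) = (norm1 (pos (take k w) - pos (take i w)) == 1)%N.
  move=> i_n kn; rewrite /e /induced_adj !val_g // lattice_adjE /walk_at.
  by rewrite -norm1N opprB addrAC opprD addrA addrN sub0r addrC.
have e_sym : symmetric e.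
  by move=> x y; rewrite /e /induced_adj !lattice_adjE -norm1N opprB.
have e_irr : irreflexive e.
  by move=> x; rewrite /e /induced_adj lattice_adjE subrr norm1_0.
have g_onto x : exists2 i, (i <= n)%N & g i = x.
  have := valP x; rewrite in_fset_seq => /mapP[i]; rewrite mem_iota => iN xE.
  by exists i; [lia|apply: val_inj; rewrite val_g //; lia].
have g_step i : (i < n)%N -> e (g i) (g i.+1).
  move=> i_n; rewrite e_gg //; try lia.
  have a0 : dir d by case: w @n i_n => [|a].
  rewrite (take_nth a0 i_n) -cats1 pos_cat addrAC subrr add0r.
  by rewrite pos_cons pos_nil addr0 norm1_step.
have C_cut t : (0 < t <= n)%N -> time_cut w t -> cut e g n t.
  move=> tn /allP cut_t i k it kt.
  have := cut_t i; rewrite mem_iota => /(_ ltac:(lia)) /allP /(_ k).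
  rewrite mem_iota => /(_ ltac:(lia)) far.
  split; last by rewrite e_gg //; lia.
  apply: contraTneq far => /(congr1 val); rewrite !val_g; try lia.
  by move/addrI ->; rewrite subrr norm1_0.
apply: (@Psi_law_ge_half _ e (walk_connected e_sym g_onto g_step) R _ (g 0%N)).
move=> x y xyE.
have g0 : val (g 0%N) = v by rewrite val_g // /walk_at take0 pos_nil addr0.
have [||] := gdiam_start e_sym e_irr g_onto g_step C_cut cut1 n0 _ xyE.
- move=> s sn; have := good_w s; rewrite mem_iota => /(_ ltac:(lia)) /hasP[t].
  rewrite mem_iota => tN /andP[/orP tC lt_t]; exists t; split=> //; first lia.
  by case: tC => [/eqP|]; [left|right].
- by move=> ->; left; rewrite g0.
- by move=> ->; right; rewrite g0.
Qed.

End WalkGraph.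

Lemma step_inj d : injective (@step d).
Proof.
move=> [i b] [j c] /rowP /(_ i); rewrite !mxE /= eqxx.
by case: eqP => [->|_]; case: b; case: c.
Qed.

(** Distinct words give disjoint cylinders. *)
Lemma walk_at_inj d (v : 'rV[int]_d) (s t : seq (dir d)) : size s = size t ->
  (forall i, (i <= size s)%N -> walk_at v s i = walk_at v t i) -> s = t.
Proof.
move=> st eq_at; suff take_eq i : (i <= size s)%N -> take i s = take i t.
  by rewrite -(take_size s) take_eq // st take_size.
elim: i => [|i IHi] i_s; first by rewrite !take0.
have a : dir d by case: (s) i_s => [|a].
have := eq_at _ i_s; rewrite /walk_at (take_nth a i_s) (take_nth a); last first.
  by rewrite -st.
rewrite -!cats1 !pos_cat IHi; last exact: ltnW.
by move=> /addrI/addrI; rewrite !pos_cons pos_nil !addr0 => /step_inj ->.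
Qed.

Section Law.
Local Open Scope classical_set_scope.
Variables (R : realType) (d : nat) (disp : measure_display)
  (Om : measurableType disp) (P : probability Om R) (v : 'rV[int]_d)
  (X : nat -> Om -> 'rV[int]_d).
Hypothesis hX : is_srw P v X.

Definition cylinder (w : seq (dir d)) : set Om :=
  [set om | forall i, (i <= size w)%N -> X i om = walk_at v w i].

Lemma cylinder_measurable w : measurable (cylinder w).
Proof.
have -> : cylinder w =
    \bigcap_(i in `I_(size w).+1) (X i @^-1` [set walk_at v w i]).
  by apply/seteqP; split=> om /= omw i; apply: omw.
by apply: bigcap_measurable => [|i _]; [exists 0%N|apply: hX.1].
Qed.

Lemma cylinder_prob w : P (cylinder w) = ((2 * d)%:R^-1 ^+ size w)%:E.
Proof.
rewrite hX.2 {1}/walk_at take0 pos_nil addr0 eqxx mul1r; congr (_%:E).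
have -> : (2 * d)%:R^-1 ^+ size w = \prod_(i < size w) (2 * d)%:R^-1 :> R.
  by rewrite prodr_const card_ord.
apply: eq_bigr => i _; rewrite /srw_step lattice_adjE /walk_at.
have a : dir d by case: w i => [[]|].
rewrite (take_nth a (ltn_ord i)) -cats1 pos_cat -norm1N opprB.
by rewrite [v + (_ + _)]addrA [_ - (v + _)]addrC addKr pos_cons pos_nil addr0 norm1_step.
Qed.

Lemma visited_cylinder w om : cylinder w om ->
  visited X (size w) om = walk_range v w.
Proof.
move=> om_w; rewrite /visited /walk_range.
have -> : [seq X i om | i <- iota 0 (size w).+1] =
    [seq walk_at v w i | i <- iota 0 (size w).+1]; last by [].
apply/eq_in_map => i.
by rewrite mem_iota => i_w; apply: om_w; lia.
Qed.

(** The integral of a nonnegative function is the supremum over the simple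
functions below it; half of the indicator of the good walks is one of them. *)
Lemma Psi_hits_ge n : (0 < n)%N ->
  ((2^-1 * mean n (fun w : seq (dir d) => (good w)%:R))%:E <= Psi_hits P X v n)%E.
Proof.
move=> n0; pose good_words :=
  [seq t : n.-tuple (dir d) <- enum {: n.-tuple (dir d)} | good t].
pose D := \bigcup_(t in [set` good_words]) cylinder t.
have mD : measurable D.
  by apply: fin_bigcup_measurable => [|t _];
    [exact: finite_seq|exact: cylinder_measurable].
have trivD : trivIset [set` good_words] (fun t : n.-tuple (dir d) => cylinder t).
  move=> s t _ _ [om [om_s om_t]]; apply/val_inj/(@walk_at_inj _ v).
    by rewrite !size_tuple.
  by move=> i i_s; rewrite -om_s // om_t // size_tuple -(size_tuple s).
have PD : P D = (mean n (fun w : seq (dir d) => (good w)%:R))%:E.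
  rewrite (measure_fin_bigcup P (finite_seq _) trivD); last first.
    by move=> t _; exact: cylinder_measurable.
  rewrite -fsbig_seq; last exact/filter_uniq/enum_uniq.
  rewrite big_filter big_enum_cond /= mean_tuple card_dir mulr_sumr -sumEFin.
  rewrite big_mkcond; apply: eq_bigr => t _; rewrite cylinder_prob size_tuple.
  by case: (good t); rewrite ?mulr1 ?mulr0.
have Psi_ge0 om : 0 <= Psi_law (@induced_adj d (visited X n om)) R (fun x => val x == v).
  by apply: sumr_ge0 => p _; rewrite mulr_ge0 ?invr_ge0 ?addr_ge0
    ?mulr_ge0 ?ler0n ?invr_ge0.
rewrite /Psi_hits unlock ge0_integralTE; last by move=> om; rewrite lee_fin.
have half0 : 0 <= 2^-1 :> R by rewrite invr_ge0.
pose h := scale_nnsfun (indic_nnsfun R mD) half0.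
apply: ereal_sup_ubound; exists h => /=; last first.
  by rewrite sintegralrM sintegral_indic // [X in (_ * X)%E]PD EFinM.
move=> om; rewrite lee_fin /= measurable_realfun.mindicE.
have [|_] := boolP (om \in D); last by rewrite mulr0.
rewrite inE mulr1 => -[t]; rewrite /= mem_filter => /andP[good_t _] om_t.
have := visited_cylinder om_t; rewrite size_tuple => ->.
by apply: good_Psi; rewrite ?size_tuple.
Qed.

End Law.

Theorem theorem1p7 (R : realType) (d : nat) (hd : (5 <= d)%N)
    (disp : measure_display) (Om : measurableType disp)
    (P : probability Om R) (v : 'rV[int]_d) (X : nat -> Om -> 'rV[int]_d)
    (hX : is_srw P v X) :
  (0 < limn_einf (Psi_hits P X v))%E.
Proof.
have d0 : (0 < d)%N by apply: leq_trans hd.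
have [J [delta delta0 delta_le]] := good_probability R hd (Ordinal d0, true).
have half_delta0 : 0 < 2^-1 * delta by rewrite mulr_gt0 ?invr_gt0.
apply: (@lt_le_trans _ _ (2^-1 * delta)%:E); first by rewrite lte_fin.
rewrite limn_einf_lim; apply: lime_ge; first exact: is_cvg_einfs.
near=> m; apply: le_ereal_inf_tmp => _ [n /= mn <-].
have Jm : (J.+1 <= m)%N by near: m; exists J.+1.
apply: le_trans (Psi_hits_ge hX _); last by lia.
by rewrite lee_fin ler_wpM2l ?invr_ge0 // delta_le //; lia.
Unshelve. all: by end_near. Qed.
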